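(* Let $\phi$ be a Drinfeld $A[\underline{t}_s]$-module over $\mathbb{T}_s$ with $\phi_\theta=\theta+A_1\tau+\dots+A_r\tau^r$, $A_r\in\mathbb{T}_s^\times$. If $\phi$ has a rigid analytic trivialization, then $\phi$ is uniformizable, i.e. $\exp_\phi:\mathbb{T}_s\to\mathbb{T}_s$ is surjective.
   Context: $\mathbb{F}_q$ finite field, $\theta,t_1,\dots,t_s,z$ independent variables, $A[\underline{t}_s]=\mathbb{F}_q[\theta,t_1,\dots,t_s]$, $\mathbb{F}_q[\underline{t}_s]=\mathbb{F}_q[t_1,\dots,t_s]$. $\mathbb{C}_\infty$: completion of an algebraic closure of $\mathbb{F}_q((1/\theta))$, $|\theta|_\infty=q$. $\mathbb{T}_s$: Tate algebra of power series in $t_1,\dots,t_s$ over $\mathbb{C}_\infty$ with coefficients tending to $0$, Gauss norm $\|\cdot\|_\infty$. $\tau$: automorphism raising $\mathbb{C}_\infty$-coefficients to the $q$-th power, $f^{(n)}=\tau^n(f)$ ($n\in\mathbb{Z}$), applied entrywise to matrices and coefficientwise to power series in $z$. $\mathbb{T}_s[\tau]$, $\mathbb{T}_s[[\tau]]$: twisted rings with $\tau f=f^{(1)}\tau$, acting by $\sum a_i\tau^i(f)=\sum a_if^{(i)}$. A Drinfeld $A[\underline{t}_s]$-module is an $\mathbb{F}_q[\underline{t}_s]$-algebra homomorphism $\phi:A[\underline{t}_s]\to\mathbb{T}_s[\tau]$ with $\phi_\theta=\theta+A_1\tau+\dots+A_r\tau^r$; $\exp_\phi=\sum\alpha_i\tau^i$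 is the unique series with $\alpha_0=1$, $\exp_\phi a=\phi_a\exp_\phi$, converging on $\mathbb{T}_s$. $\mathbb{T}_s\{z/\theta\}=\{\sum_{i\ge0}a_iz^i: a_i\in\mathbb{T}_s,\ q^i\|a_i\|_\infty\to0\}$. $\Phi\in\mathrm{Mat}_r(\mathbb{T}_s[z])$ has $i$-th row the $(i+1)$-st standard basis row vector for $1\le i\le r-1$ and last row $\big[(z-\theta)/A_r^{(-r)},-A_1^{(-1)}/A_r^{(-r)},\dots,-A_{r-1}^{(-r+1)}/A_r^{(-r)}\big]$. A rigid analytic trivialization of $\phi$ is a $\Psi\in\mathrm{GL}_r(\mathbb{T}_s\{z/\theta\})$ with $\Psi^{(-1)}=\Phi\Psi$. *)

(* Defs.v *)
From HB Require Import structures.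
From mathcomp Require Import all_boot all_order all_algebra.
From mathcomp Require Import reals.
From Stdlib Require Import ClassicalEpsilon.
Set Implicit Arguments. Unset Strict Implicit. Unset Printing Implicit Defensive.
Import Order.TTheory GRing.Theory Num.Theory.
Local Open Scope ring_scope.

(* theta : C.  is_Cinfty q theta abs states that (C, |.|) is           *)
(* (isometrically isomorphic to) the completion of an algebraic        *)
(* closure of F_q((1/theta)) with |theta| = q:                          *)
Section Cinfty.
Variables (R : realType) (C : closedFieldType).

Definition in_Fq (q : nat) (c : C) := c ^+ q = c.

(* y is algebraic over F_q(theta): root of a nonzero polynomial with   *)
(* coefficients in F_q[theta] (denominators cleared).                  *)
Definition algebraic_over_Fq_theta (q : nat) (theta : C) (y : C) :=
  exists P : {poly {poly C}},
    (forall i j, in_Fq q (P`_i)`_j) /\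
    map_poly (fun Q : {poly C} => Q.[theta]) P != 0 /\
    (map_poly (fun Q : {poly C} => Q.[theta]) P).[y] = 0.

Definition is_Cinfty (q : nat) (theta : C) (abs : C -> R) : Prop :=
  [/\ (exists p e : nat, [/\ prime p, (0 < e)%N, q = (p ^ e)%N & p \in [pchar C]]),
      (forall x, 0 <= abs x /\ (abs x = 0 <-> x = 0)),
      (forall x y, abs (x * y) = abs x * abs y),
      (forall x y, abs (x + y) <= Num.max (abs x) (abs y)) /\
      abs theta = q%:R
    &
      (forall u : nat -> C,
        (forall eps : R, 0 < eps -> exists N, forall m n, (N <= m)%N -> (N <= n)%N ->
            abs (u m - u n) < eps) ->
        exists l, forall eps : R, 0 < eps -> exists N, forall n, (N <= n)%N ->
            abs (u n - l) < eps) /\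
      (forall (x : C) (eps : R), 0 < eps ->
        exists y, algebraic_over_Fq_theta q theta y /\ abs (x - y) < eps)].

(* q-Frobenius and its inverse (q-th root, exists as C is alg. closed) *)
Definition qroot (q : nat) (x : C) : C :=
  epsilon (inhabits 0) (fun y : C => y ^+ q = x).

Definition frobz (q : nat) (n : int) (x : C) : C :=
  match n with
  | Posz k => iter k (fun y => y ^+ q) x
  | Negz k => iter k.+1 (qroot q) x
  end.
End Cinfty.

Definition mi (s : nat) := {ffun 'I_s -> nat}.
Definition mdeg (s : nat) (m : mi s) : nat := (\sum_i m i)%N.

Section Series.
Variables (R : realType) (C : closedFieldType) (s : nat).

Definition pser := mi s -> C.

Definition pzero : pser := fun _ => 0.
Definition pconst (c : C) : pser := fun m => if m == [ffun => 0%N] then c else 0.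
Definition padd (f g : pser) : pser := fun m => f m + g m.
Definition popp (f : pser) : pser := fun m => - f m.
Definition pmul (f g : pser) : pser := fun m =>
  \sum_(k : {ffun 'I_s -> 'I_(mdeg m).+1} | [forall i, (k i <= m i)%N])
     f [ffun i => nat_of_ord (k i)] * g [ffun i => (m i - k i)%N].
Definition ptw (q : nat) (n : int) (f : pser) : pser := fun m => frobz q n (f m).

Definition in_tate (abs : C -> R) (f : pser) :=
  forall eps : R, 0 < eps -> exists N, forall m : mi s, (N <= mdeg m)%N -> abs (f m) < eps.

Definition gauss_le (abs : C -> R) (f : pser) (e : R) := forall m, abs (f m) <= e.

(* --- twisted power series  sum_i a_i tau^i  in T_s[[tau]] --- *)
Definition tser := nat -> pser.
Definition tsmul (q : nat) (a b : tser) : tser := fun n =>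
  \big[padd/pzero]_(i < n.+1) pmul (a i) (ptw q (Posz i) (b (n - i)%N)).

Definition phi_theta (theta : C) (r : nat) (A : nat -> pser) : tser := fun n =>
  if n == 0%N then pconst theta else if (n <= r)%N then A n else pzero.
Definition theta_ts (theta : C) : tser := fun n =>
  if n == 0%N then pconst theta else pzero.

Definition is_exp (q : nat) (theta : C) (r : nat) (A : nat -> pser) (alpha : tser) :=
  alpha 0%N = pconst 1 /\
  forall n m, tsmul q alpha (theta_ts theta) n m = tsmul q (phi_theta theta r A) alpha n m.

Definition exp_partial (q : nat) (alpha : tser) (f : pser) (N : nat) : pser :=
  \big[padd/pzero]_(i < N) pmul (alpha i) (ptw q (Posz i) f).

Definition uniformizable (abs : C -> R) (q : nat) (alpha : tser) :=
  forall g : pser, in_tate abs g ->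
    exists f : pser, in_tate abs f /\
      forall eps : R, 0 < eps -> exists N0, forall N, (N0 <= N)%N ->
        gauss_le abs (padd (exp_partial q alpha f N) (popp g)) eps.

(* --- power series in z with coefficients in T_s: zser a = sum_i a i z^i --- *)
Definition zser := nat -> pser.
Definition zzero : zser := fun _ => pzero.
Definition zconst (f : pser) : zser := fun n => if n == 0%N then f else pzero.
Definition zadd (a b : zser) : zser := fun n => padd (a n) (b n).
Definition zmul (a b : zser) : zser := fun n =>
  \big[padd/pzero]_(i < n.+1) pmul (a i) (b (n - i)%N).
Definition ztw (q : nat) (n : int) (a : zser) : zser := fun k => ptw q n (a k).

(* membership in T_s{z/theta}: a_i in T_s and q^i ||a_i|| -> 0 *)
Definition in_tate_z (abs : C -> R) (q : nat) (a : zser) :=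
  (forall i, in_tate abs (a i)) /\
  forall eps : R, 0 < eps -> exists N, forall i, (N <= i)%N ->
     forall m, (q%:R ^+ i : R) * abs (a i m) <= eps.

Definition zmx (r : nat) := 'I_r -> 'I_r -> zser.
Definition zmx_mul (r : nat) (M N : zmx r) : zmx r := fun i j =>
  \big[zadd/zzero]_(k < r) zmul (M i k) (N k j).
Definition zmx_one (r : nat) : zmx r := fun i j =>
  if i == j then zconst (pconst 1) else zzero.
Definition zmx_tw (q : nat) (n : int) (r : nat) (M : zmx r) : zmx r :=
  fun i j => ztw q n (M i j).
Definition zmx_eq (r : nat) (M N : zmx r) := forall i j n m, M i j n m = N i j n m.

(* the matrix Phi, where Binv is the inverse of A_r in T_s, so that
   Binv^(-r) = 1 / A_r^(-r) *)
Definition Phi (q : nat) (theta : C) (r : nat) (A : nat -> pser) (Binv : pser) : zmx r :=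
  fun i j =>
    let Br := ptw q (- (r%:Z)) Binv in
    if (i.+1 < r)%N then
      (if (j == i.+1 :> nat) then zconst (pconst 1) else zzero)
    else if (j == 0%N :> nat) then
      (fun n => if n == 0%N then pmul (pconst (- theta)) Br
                else if n == 1%N then Br else pzero)
    else zconst (popp (pmul (ptw q (- (j%:Z)) (A j)) Br)).

Definition rigid_analytic_trivialization (abs : C -> R) (q : nat) (theta : C)
   (r : nat) (A : nat -> pser) (Binv : pser) (Psi : zmx r) :=
  [/\ forall i j, in_tate_z abs q (Psi i j),
      (exists Psi' : zmx r, (forall i j, in_tate_z abs q (Psi' i j)) /\
         zmx_eq (zmx_mul Psi Psi') (@zmx_one r) /\ zmx_eq (zmx_mul Psi' Psi) (@zmx_one r))
    & zmx_eq (zmx_tw q (-1) Psi) (zmx_mul (Phi q theta A Binv) Psi)].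
End Series.

(* Main.v *)
(** If psi is a column of Psi, its first entry is killed by the adjoint of
    phi_theta - z, so Psi is a fundamental matrix for that operator. Variation of
    constants therefore solves phi_theta(u) = z u + xi in T_s{z} for every xi in
    T_s: one only needs solutions of the scalar equations h^(1) - h = c, which is
    Artin-Schreier theory in C_oo applied to each coefficient. The coefficients of
    u = sum u_n z^n form a theta-division tower phi_theta(u_0) = xi,
    phi_theta(u_(n+1)) = u_n with u_n -> 0. As exp_phi is close to the identity on a
    small ball, some u_N is exp_phi(x), and exp_phi(theta^(N+1) x) =
    phi_(theta^(N+1))(u_N) = xi. *)

Require Import Defs.
From HB Require Import structures.
From mathcomp Require Import all_boot all_order all_algebra.
From mathcomp Require Import reals boolp.
From mathcomp Require Import lra.
Set Implicit Arguments. Unset Strict Implicit. Unset Printing Implicit Defensive.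
Import Order.TTheory GRing.Theory Num.Theory.
Local Open Scope ring_scope.

(** * Rings of power series *)

(** The delicate point is decay. The solutions of h^(1) - h = c in C_oo form a coset of F_q, whose
    nonzero elements have absolute value 1. A careless choice, made coefficient by coefficient,
    would thus leave T_s and also lose the decay in z. Choosing, whenever |c| < 1, the solution with
    |h| <= |c| preserves both kinds of decay at once, and a single u_n of small norm is all that the
    last step asks for. The estimates on exp_phi rest on one constant M >= 1 bounding all
    coefficients of phi_theta. Comparing coefficients in exp_phi theta = phi_theta exp_phi forces a
    division by theta^(q^n) - theta, of absolute value q^(q^n). This gain makes exp_phi converge on
    all of T_s. Even without it one has M |alpha_n| <= M^(q^n), so exp_phi is a small perturbation
    of the identity on the ball of radius 1/(2M), and successive approximation inverts it there. *)

Section MultiIndex.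
Variable s : nat.
Implicit Types k l m : mi s.

Definition mi_le k m := [forall i, (k i <= m i)%N].
Definition mi_add k l : mi s := [ffun i => (k i + l i)%N].
Definition mi_sub m k : mi s := [ffun i => (m i - k i)%N].
Definition mi_box (N : nat) : seq (mi s) :=
  [seq [ffun i => nat_of_ord (k i)] | k : {ffun 'I_s -> 'I_N.+1}].

Lemma mi_leP k m : reflect (forall i, (k i <= m i)%N) (mi_le k m).
Proof. exact: forallP. Qed.

Lemma mi_le_trans k l m : mi_le k l -> mi_le l m -> mi_le k m.
Proof. by move=> /mi_leP h /mi_leP h'; apply/mi_leP => i; apply: leq_trans (h i) _. Qed.

Lemma mi_subK k m : mi_le k m -> mi_add k (mi_sub m k) = m.
Proof. by move=> /mi_leP h; apply/ffunP => i; rewrite !ffunE subnKC. Qed.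

Lemma mi_sub_le m k : mi_le (mi_sub m k) m.
Proof. by apply/mi_leP => i; rewrite ffunE leq_subr. Qed.

Lemma mi_subKC k m : mi_le k m -> mi_sub m (mi_sub m k) = k.
Proof. by move=> /mi_leP h; apply/ffunP => i; rewrite !ffunE subKn. Qed.

Lemma mi_addK k l : mi_sub (mi_add k l) k = l.
Proof. by apply/ffunP => i; rewrite !ffunE addKn. Qed.

Lemma mi_le_addr k l : mi_le k (mi_add k l).
Proof. by apply/mi_leP => i; rewrite ffunE leq_addr. Qed.

Lemma mi_addA_sub m k l : mi_sub m (mi_add k l) = mi_sub (mi_sub m k) l.
Proof. by apply/ffunP => i; rewrite !ffunE subnDA. Qed.

Lemma mi_le_add m k l : mi_le k m -> mi_le (mi_add k l) m = mi_le l (mi_sub m k).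
Proof.
move=> /mi_leP h; apply/mi_leP/mi_leP => h' i; move: (h' i) (h i); rewrite !ffunE.
  by move=> h1 h2; rewrite leq_subRL.
by move=> h1 h2; rewrite -leq_subRL.
Qed.

Lemma mi_box_uniq N : uniq (mi_box N).
Proof.
rewrite map_inj_uniq ?enum_uniq // => k l /ffunP h.
by apply/ffunP => i; apply: val_inj; move: (h i); rewrite !ffunE.
Qed.

Lemma coord_le_mdeg m i : (m i <= mdeg m)%N.
Proof. by rewrite /mdeg (bigD1 i) //= leq_addr. Qed.

Lemma mem_mi_box N m : (mdeg m <= N)%N -> m \in mi_box N.
Proof.
move=> h; apply/mapP; exists [ffun i => inord (m i)]; first by rewrite mem_enum.
apply/ffunP => i; rewrite !ffunE inordK // ltnS.
exact: leq_trans (coord_le_mdeg m i) h.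
Qed.

Lemma mdeg_le k m : mi_le k m -> (mdeg k <= mdeg m)%N.
Proof. by move=> /mi_leP h; apply: leq_sum => i _. Qed.

Lemma mdeg_sub k m : mi_le k m -> (mdeg k + mdeg (mi_sub m k) = mdeg m)%N.
Proof.
move=> /mi_subK h; rewrite -{2}h /mdeg -big_split /=.
by apply: eq_bigr => i _; rewrite !ffunE.
Qed.

Lemma mem_filter_box N m k : (mdeg m <= N)%N ->
  (k \in [seq l <- mi_box N | mi_le l m]) = mi_le k m.
Proof.
move=> h; rewrite mem_filter; case: (boolP (mi_le k m)) => //= hk.
by rewrite mem_mi_box // (leq_trans (mdeg_le hk)).
Qed.

End MultiIndex.

(** * Power series in t_1, .., t_s form a commutative ring *)

Section PserRing.
Variables (C : closedFieldType) (s : nat).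
Implicit Types f g h : pser C s.

(** The sum in [pmul] ranges over a box that depends on [m]. A box of free size [N] gives the
    products at [m] and at all smaller indices one common range, which the exchange of sums in
    [pmulA] requires. *)
Lemma pmulE N f g m : (mdeg m <= N)%N ->
  pmul f g m = \sum_(k <- mi_box s N | mi_le k m) f k * g (mi_sub m k).
Proof.
move=> hN; rewrite -big_filter.
transitivity (\sum_(k <- [seq k <- mi_box s (mdeg m) | mi_le k m]) f k * g (mi_sub m k)).
  rewrite big_filter big_map big_enum_cond /=; apply: eq_big => k.
    by apply: eq_forallb => i; rewrite ffunE.
  by move=> _; congr (_ * g _); apply/ffunP => i; rewrite !ffunE.
apply: perm_big; apply: uniq_perm; rewrite ?filter_uniq ?mi_box_uniq // => k.
by rewrite !mem_filter_box.
Qed.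

Lemma pmulC : commutative (@pmul C s).
Proof.
move=> f g; apply/funext => m; rewrite !(pmulE _ _ (leqnn _)).
rewrite -big_filter -[RHS]big_filter.
have P : perm_eq [seq k <- mi_box s (mdeg m) | mi_le k m]
    [seq mi_sub m k | k <- [seq k <- mi_box s (mdeg m) | mi_le k m]].
  apply: uniq_perm; rewrite ?filter_uniq ?mi_box_uniq //.
    rewrite map_inj_in_uniq ?filter_uniq ?mi_box_uniq // => k l.
    by rewrite !mem_filter_box // => hk hl e; rewrite -(mi_subKC hk) e mi_subKC.
  move=> k; rewrite mem_filter_box //; apply/idP/mapP.
    by move=> hk; exists (mi_sub m k); rewrite ?mem_filter_box ?mi_sub_le ?mi_subKC.
  by case=> l; rewrite mem_filter_box // => hl ->; apply: mi_sub_le.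
rewrite (perm_big _ P) big_map; apply: eq_big_seq => k.
by rewrite mem_filter_box // => hk; rewrite mi_subKC // mulrC.
Qed.

Lemma pmulA : associative (@pmul C s).
Proof.
move=> f g h; apply/funext => m; set N := mdeg m.
rewrite !(@pmulE N) //.
(* Both sides are the sum over chains a <= k <= m; on the left, k = a + b with b the inner index. *)
transitivity (\sum_(a <- mi_box s N | mi_le a m) \sum_(k <- mi_box s N | mi_le a k && mi_le k m)
    f a * g (mi_sub k a) * h (mi_sub m k)).
  apply: eq_bigr => a ha; rewrite (@pmulE N); last exact: mdeg_le (mi_sub_le m a).
  rewrite mulr_sumr -big_filter -[RHS]big_filter.
  have P : perm_eq [seq k <- mi_box s N | mi_le a k && mi_le k m]
     [seq mi_add a b | b <- [seq b <- mi_box s N | mi_le b (mi_sub m a)]].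
    apply: uniq_perm; rewrite ?filter_uniq ?mi_box_uniq //.
      rewrite map_inj_uniq ?filter_uniq ?mi_box_uniq // => k l e.
      by rewrite -(mi_addK a k) e mi_addK.
    have hN : (mdeg (mi_sub m a) <= N)%N by apply: mdeg_le (mi_sub_le m a).
    move=> k; rewrite mem_filter; apply/idP/mapP.
      move=> /andP[/andP[h1 h2] _]; exists (mi_sub k a); last by rewrite mi_subK.
      by rewrite mem_filter_box // -mi_le_add // mi_subK.
    case=> b; rewrite mem_filter_box // => hb ->.
    have hab : mi_le (mi_add a b) m by rewrite mi_le_add.
    by rewrite mi_le_addr hab mem_mi_box // mdeg_le.
  rewrite (perm_big _ P) big_map; apply: eq_bigr => b _.
  by rewrite mi_addK mi_addA_sub mulrA.
rewrite (exchange_big_dep (fun k => mi_le k m)) /=; last by move=> a k _ /andP[].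
apply: eq_bigr => k hk; rewrite (@pmulE N) ?mdeg_le // mulr_suml.
apply: eq_bigl => a; case: (boolP (mi_le a k)) => //= hak; last by rewrite andbF.
by rewrite hk (mi_le_trans hak).
Qed.

Lemma pmul_const (c : C) f m : pmul (@pconst C s c) f m = c * f m.
Proof.
rewrite (pmulE _ _ (leqnn _)) -big_filter (bigD1_seq [ffun => 0%N]) /=.
- rewrite big1 ?addr0 => [|k /negPf hk].
    rewrite /pconst eqxx; congr (_ * f _); apply/ffunP => i.
    by rewrite !ffunE subn0.
  by rewrite /pconst hk mul0r.
- by rewrite mem_filter_box //; apply/mi_leP => i; rewrite ffunE.
by rewrite filter_uniq ?mi_box_uniq.
Qed.

Lemma pmul1 : left_id (@pconst C s 1) (@pmul C s).
Proof. by move=> f; apply/funext => m; rewrite pmul_const mul1r. Qed.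

Lemma pmulDl : left_distributive (@pmul C s) (@padd C s).
Proof.
move=> f g h; apply/funext => m; rewrite /padd /pmul -big_split /=.
by apply: eq_bigr => k _; rewrite mulrDl.
Qed.

Lemma paddA : associative (@padd C s).
Proof. by move=> f g h; apply/funext => m; rewrite /padd addrA. Qed.
Lemma paddC : commutative (@padd C s).
Proof. by move=> f g; apply/funext => m; rewrite /padd addrC. Qed.
Lemma padd0 : left_id (@pzero C s) (@padd C s).
Proof. by move=> f; apply/funext => m; rewrite /padd add0r. Qed.
Lemma paddN : left_inverse (@pzero C s) (@popp C s) (@padd C s).
Proof. by move=> f; apply/funext => m; rewrite /padd /popp addNr. Qed.

HB.instance Definition _ := gen_eqMixin (pser C s).
HB.instance Definition _ := gen_choiceMixin (pser C s).
HB.instance Definition _ := GRing.isZmodule.Build (pser C s) paddA paddC padd0 paddN.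

Lemma pconst1_neq0 : @pconst C s 1 != 0 :> pser C s.
Proof.
apply/eqP => /(congr1 (fun f => f [ffun => 0%N])); rewrite /pconst eqxx.
by move/eqP; rewrite (negPf (oner_neq0 C)).
Qed.

HB.instance Definition _ :=
  GRing.Zmodule_isComNzRing.Build (pser C s) pmulA pmulC pmul1 pmulDl pconst1_neq0.

Lemma paddE f g : padd f g = f + g. Proof. by []. Qed.
Lemma coefpD f g m : (f + g) m = f m + g m. Proof. by []. Qed.
Lemma coefpN f m : (- f) m = - f m. Proof. by []. Qed.
Lemma coefpB f g m : (f - g) m = f m - g m. Proof. by []. Qed.
Lemma coefp_const (c : C) f m : (@pconst C s c * f) m = c * f m.
Proof. exact: pmul_const. Qed.
Lemma coefp_sum I (r : seq I) (P : pred I) (F : I -> pser C s) m :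
  (\sum_(i <- r | P i) F i) m = \sum_(i <- r | P i) F i m.
Proof. by elim/big_ind2: _ => // x1 x2 y1 y2; rewrite coefpD => -> ->. Qed.
Lemma coefp_mul f g m :
  (f * g) m = \sum_(k <- mi_box s (mdeg m) | mi_le k m) f k * g (mi_sub m k).
Proof. exact: pmulE. Qed.
Lemma pserP f g : f =1 g -> f = g.
Proof. exact: funext. Qed.

End PserRing.

(** * Power series in z over the previous ring *)

Section ZserRing.
Variables (C : closedFieldType) (s : nat).
Implicit Types a b c : zser C s.

(** The coefficient of z^n in a product involves only coefficients up to n, so commutativity and
    associativity can be inherited from polynomials. *)
Let trunc N a : {poly pser C s} := \poly_(i < N) a i.

Lemma zmulE N a b n : (n < N)%N -> zmul a b n = (trunc N a * trunc N b)`_n.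
Proof.
move=> hn; rewrite coefM; apply: eq_bigr => i _.
by rewrite !coef_poly !(leq_ltn_trans _ hn) ?leq_subr // -ltnS.
Qed.

Let zmulE' N a (p : {poly pser C s}) n : (n < N)%N ->
  (trunc N a * p)`_n = \sum_(i < n.+1) a i * p`_(n - i).
Proof.
move=> hn; rewrite coefM; apply: eq_bigr => i _.
by rewrite !coef_poly (leq_ltn_trans _ hn) // -ltnS.
Qed.

Definition zopp a : zser C s := fun n => - a n.
Lemma zaddA : associative (@zadd C s).
Proof. by move=> f g h; apply/funext => m; rewrite /zadd paddA. Qed.
Lemma zaddC : commutative (@zadd C s).
Proof. by move=> f g; apply/funext => m; rewrite /zadd paddC. Qed.
Lemma zadd0 : left_id (@zzero C s) (@zadd C s).
Proof. by move=> f; apply/funext => m; rewrite /zadd padd0. Qed.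
Lemma zaddN : left_inverse (@zzero C s) zopp (@zadd C s).
Proof. by move=> f; apply/funext => m; rewrite /zadd paddN. Qed.

HB.instance Definition _ := gen_eqMixin (zser C s).
HB.instance Definition _ := gen_choiceMixin (zser C s).
HB.instance Definition _ := GRing.isZmodule.Build (zser C s) zaddA zaddC zadd0 zaddN.

Lemma zmulC : commutative (@zmul C s).
Proof.
by move=> a b; apply/funext => n; rewrite !(zmulE _ _ (ltnSn n)) mulrC.
Qed.

Lemma zmulA : associative (@zmul C s).
Proof.
have H a b c n : zmul a (zmul b c) n = (trunc n.+1 a * (trunc n.+1 b * trunc n.+1 c))`_n.
  rewrite zmulE'; last exact: ltnSn.
  by apply: eq_bigr => i _; rewrite (@zmulE n.+1) // ltnS leq_subr.
move=> a b c; apply/funext => n; rewrite [zmul (zmul a b) c]zmulC !H.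
by rewrite mulrA [trunc _ c * _]mulrC.
Qed.

Lemma zmul_sum a b n : zmul a b n = \sum_(i < n.+1) a i * b (n - i)%N.
Proof. by []. Qed.

Lemma zmul_const (f : pser C s) a n : zmul (zconst f) a n = f * a n.
Proof.
rewrite zmul_sum big_ord_recl /= subn0 [X in _ + X]big1 ?addr0 // => i _; exact: mul0r.
Qed.

Lemma zmul1 : left_id (zconst (@pconst C s 1)) (@zmul C s).
Proof. by move=> f; apply/funext => m; rewrite zmul_const mul1r. Qed.

Lemma zmulDl : left_distributive (@zmul C s) (@zadd C s).
Proof.
move=> f g h; apply/funext => m; rewrite /zadd !zmul_sum paddE -big_split /=.
by apply: eq_bigr => k _; apply: mulrDl.
Qed.

Lemma zone_neq0 : zconst (@pconst C s 1) != 0 :> zser C s.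
Proof.
apply/eqP => /(congr1 (fun f => f 0%N)) /eqP; apply/negP; exact: oner_neq0.
Qed.

HB.instance Definition _ :=
  GRing.Zmodule_isComNzRing.Build (zser C s) zmulA zmulC zmul1 zmulDl zone_neq0.

Lemma coefzD a b n : (a + b) n = a n + b n. Proof. by []. Qed.
Lemma coefzN a n : (- a) n = - a n. Proof. by []. Qed.
Lemma coefz_const f a n : (zconst f * a) n = f * a n.
Proof. exact: zmul_const. Qed.
Lemma coefz_mul a b n : (a * b) n = \sum_(i < n.+1) a i * b (n - i)%N.
Proof. by []. Qed.
Lemma coefz_sum I (r : seq I) (P : pred I) (F : I -> zser C s) m :
  (\sum_(i <- r | P i) F i) m = \sum_(i <- r | P i) F i m.
Proof. by elim/big_ind2: _ => // x1 x2 y1 y2; rewrite coefzD => -> ->. Qed.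

Definition zX : zser C s := fun n => if n == 1%N then 1 else 0.

Lemma coefzXM a n : (zX * a) n = if n is k.+1 then a k else 0.
Proof.
rewrite coefz_mul; case: n => [|n].
  by rewrite big_ord1 mul0r.
rewrite 2!big_ord_recl /= mul0r add0r mul1r big1 ?addr0 ?subSS ?subn0 // => i _.
by rewrite mul0r.
Qed.

End ZserRing.

Section MapRing.
Variables (C : closedFieldType) (s : nat) (g : {rmorphism C -> C}).

Definition pser_map (f : pser C s) : pser C s := fun m => g (f m).
Definition zser_map (a : zser C s) : zser C s := fun n => pser_map (a n).

Lemma pser_map_zmod_morphism : zmod_morphism pser_map.
Proof. by move=> x y; apply/funext => m; rewrite /pser_map !coefpB rmorphB. Qed.
HB.instance Definition _ := GRing.isZmodMorphism.Build _ _ pser_map pser_map_zmod_morphism.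

Lemma pser_map_const c : pser_map (@pconst C s c) = @pconst C s (g c).
Proof. by apply/funext => m; rewrite /pser_map /pconst; case: ifP; rewrite ?rmorph0. Qed.

Lemma pser_map_monoid_morphism : monoid_morphism pser_map.
Proof.
split; first by rewrite [1]/(@pconst C s 1) pser_map_const rmorph1.
move=> x y; apply/funext => m; rewrite /pser_map !coefp_mul rmorph_sum.
by apply: eq_bigr => k _; rewrite rmorphM.
Qed.
HB.instance Definition _ := GRing.isMonoidMorphism.Build _ _ pser_map pser_map_monoid_morphism.

Lemma zser_map_zmod_morphism : zmod_morphism zser_map.
Proof. by move=> x y; apply/funext => m; rewrite /zser_map rmorphB. Qed.
HB.instance Definition _ := GRing.isZmodMorphism.Build _ _ zser_map zser_map_zmod_morphism.

Lemma zser_map_const f : zser_map (zconst f) = zconst (pser_map f).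
Proof.
by apply/funext => m; rewrite /zser_map /zconst; case: ifP => // _; apply: rmorph0.
Qed.

Lemma zser_map_monoid_morphism : monoid_morphism zser_map.
Proof.
split; first by rewrite [1]/(zconst 1) zser_map_const rmorph1.
move=> x y; apply/funext => m; rewrite /zser_map !coefz_mul rmorph_sum.
by apply: eq_bigr => k _; rewrite rmorphM.
Qed.
HB.instance Definition _ := GRing.isMonoidMorphism.Build _ _ zser_map zser_map_monoid_morphism.

End MapRing.

(** * Valuation, Frobenius and convergence *)

Section IterRmorphism.
Variables (C : closedFieldType) (g : {rmorphism C -> C}) (n : nat).

Definition iterm : C -> C := iter n g.

Lemma iterm_zmod_morphism : zmod_morphism iterm.
Proof. by rewrite /iterm; elim: n => [|k IH] x y //=; rewrite IH rmorphB. Qed.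
HB.instance Definition _ := GRing.isZmodMorphism.Build _ _ iterm iterm_zmod_morphism.

Lemma iterm_monoid_morphism : monoid_morphism iterm.
Proof.
rewrite /iterm; split; first by elim: n => //= k ->; rewrite rmorph1.
by move=> x y; elim: n => //= k ->; rewrite rmorphM.
Qed.
HB.instance Definition _ := GRing.isMonoidMorphism.Build _ _ iterm iterm_monoid_morphism.
End IterRmorphism.

(** * Absolute value, Artin-Schreier equations and Frobenius on C_oo *)

Section Cinfty.
Variables (R : realType) (C : closedFieldType) (q : nat) (theta : C) (abs : C -> R).
Hypothesis HC : is_Cinfty q theta abs.

Lemma q_gt1 : (1 < q)%N.
Proof.
case: HC => -[p [e [p_pr e_gt0 -> _]]] _ _ _ _.
by rewrite -(expn0 p) ltn_exp2l // prime_gt1.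
Qed.

Lemma q_gt0 : (0 < q)%N. Proof. exact: ltnW q_gt1. Qed.

Lemma frobenius_add (x y : C) : (x + y) ^+ q = x ^+ q + y ^+ q.
Proof.
case: HC => -[p [e [p_pr e_gt0 -> hp]]] _ _ _ _.
by rewrite exprDn_pchar // pnatX pnatE // hp.
Qed.

Lemma abs_ge0 x : 0 <= abs x.
Proof. by case: HC => _ h _ _ _; case: (h x). Qed.

Lemma abs_eq0 x : (abs x == 0) = (x == 0).
Proof. by case: HC => _ h _ _ _; apply/eqP/eqP; case: (h x) => _ []. Qed.

Lemma absM x y : abs (x * y) = abs x * abs y.
Proof. by case: HC. Qed.

Lemma abs0 : abs 0 = 0. Proof. by apply/eqP; rewrite abs_eq0. Qed.

Lemma abs1 : abs 1 = 1.
Proof.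
have h : abs 1 != 0 by rewrite abs_eq0 oner_neq0.
by apply: (mulfI h); rewrite -absM !mulr1.
Qed.

Lemma absX x n : abs (x ^+ n) = abs x ^+ n.
Proof. by elim: n => [|n IH]; rewrite ?abs1 // !exprS absM IH. Qed.

Lemma absN x : abs (- x) = abs x.
Proof.
have h : abs (-1) = 1.
  apply/eqP; rewrite -(@pexpr_eq1 _ _ 2) ?abs_ge0 //.
  by rewrite -absX sqrrN expr1n abs1.
by rewrite -mulN1r absM h mul1r.
Qed.

Lemma abs_theta : abs theta = q%:R.
Proof. by case: HC => _ _ _ [_ ->]. Qed.

Lemma abs_add e x y : abs x <= e -> abs y <= e -> abs (x + y) <= e.
Proof.
case: HC => _ _ _ [h _] _ hx hy; apply: le_trans (h x y) _.
by rewrite ge_max hx.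
Qed.

Lemma abs_sub e x y : abs x <= e -> abs y <= e -> abs (x - y) <= e.
Proof. by move=> hx hy; apply: abs_add; rewrite ?absN. Qed.

Lemma abs_sum e I (r : seq I) (P : pred I) (F : I -> C) : 0 <= e ->
  (forall i, P i -> abs (F i) <= e) -> abs (\sum_(i <- r | P i) F i) <= e.
Proof.
move=> he h; apply: (big_ind (fun x => abs x <= e)) => //; first by rewrite abs0.
by move=> x y; apply: abs_add.
Qed.

Lemma abs_prod (r : seq C) : abs (\prod_(z <- r) z) = \prod_(z <- r) abs z.
Proof. by elim: r => [|z r IH]; rewrite ?big_nil ?abs1 // !big_cons absM IH. Qed.

(* If [abs c < 1], the roots of [X^q - X - c] have product of absolute value
   [abs c < 1], so one of them lies in the open unit disc, where
   [abs (x ^ q) < abs x]. *)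
Lemma artin_schreier c :
  exists x, x ^+ q - x = c /\ (abs c < 1 -> abs x <= abs c).
Proof.
pose P : {poly C} := 'X^q - ('X + c%:P).
have szP : size P = q.+1.
  by rewrite size_polyDl size_polyXn // size_polyN size_XaddC ltnS q_gt1.
have lcP : lead_coef P = 1.
  rewrite lead_coefDl ?lead_coefXn //.
  by rewrite size_polyXn size_polyN size_XaddC ltnS q_gt1.
have rootE x : root P x -> x ^+ q - x = c.
  rewrite /root !hornerE => /eqP h; apply/eqP.
  by rewrite -subr_eq0 -addrA -opprD h.
have [c1|c1] := ltP (abs c) 1; last first.
  have /closed_rootP [x /rootE hx] : size P != 1%N.
    by rewrite szP eqSS -lt0n q_gt0.
  by exists x.
have [r Pr] := closed_field_poly_normal P.
move: Pr; rewrite lcP scale1r => Pr.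
have [/hasP [x xr x1]|/hasPn hr] := boolP (has (fun z => abs z < 1) r).
  have hx : root P x.
    by rewrite Pr root_prod_XsubC.
  exists x; split=> [|_]; first exact: rootE.
  have xE : x = x ^+ q - c by rewrite -(rootE _ hx) subKr.
  have [//|cx] := leP (abs x) (abs c).
  have x0 : x != 0 by apply: contraTneq cx => ->; rewrite abs0 -leNgt abs_ge0.
  have hxq : abs (x ^+ q) < abs x.
    rewrite absX -[ltRHS]expr1 ltr_iXn2l ?q_gt1 // lt_def abs_eq0 x0.
    exact: abs_ge0.
  have : abs x <= Num.max (abs (x ^+ q)) (abs c).
    by rewrite {1}xE; apply: abs_sub; rewrite le_max lexx ?orbT.
  by rewrite leNgt gt_max hxq cx.
have : abs P.[0] = abs c.
  rewrite !hornerE expr0n; have /gtn_eqF -> := q_gt0.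
  by rewrite ?add0r ?sub0r ?add0r absN.
rewrite Pr horner_prod.
have -> : \prod_(z <- r) ('X - z%:P).[0] = \prod_(z <- [seq - z | z <- r]) z.
  by rewrite big_map; apply: eq_bigr => z _; rewrite !hornerE.
rewrite abs_prod big_map => e; move: c1; rewrite -e ltNge => /negP[].
rewrite big_seq; apply: (big_ind (fun x => 1 <= x)) => //.
  by move=> x y hx hy; rewrite mulr_ege1.
by move=> z /hr; rewrite -leNgt absN.
Qed.

Section Frobenius.
Definition frob (x : C) : C := x ^+ q.
Lemma frob_zmod_morphism : zmod_morphism (frob : C -> C).
Proof.
move=> x y; apply/eqP; rewrite eq_sym subr_eq /frob -frobenius_add.
by rewrite subrK.
Qed.
HB.instance Definition _ := GRing.isZmodMorphism.Build C C frob frob_zmod_morphism.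
Lemma frob_monoid_morphism : monoid_morphism (frob : C -> C).
Proof. by split; rewrite /frob ?expr1n // => x y; rewrite exprMn. Qed.
HB.instance Definition _ := GRing.isMonoidMorphism.Build C C frob frob_monoid_morphism.

Lemma qrootK (x : C) : qroot q x ^+ q = x.
Proof.
apply: (@ClassicalEpsilon.epsilon_spec C (inhabits 0) (fun y => y ^+ q = x)).
have /closed_rootP [y] : size ('X^q - x%:P : {poly C}) != 1%N.
  by rewrite size_XnsubC ?q_gt0 // eqSS -lt0n q_gt0.
by rewrite /root !hornerE subr_eq0 => /eqP; exists y.
Qed.

Lemma frob_inj : injective (frob : C -> C).
Proof.
move=> x y e; apply/eqP; rewrite -subr_eq0.
have : (x - y) ^+ q = 0 by rewrite -[LHS]/(frob (x - y)) rmorphB /= e subrr.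
by move=> /eqP; rewrite expf_eq0 => /andP[].
Qed.

(** [qroot] is picked by [epsilon], yet injectivity of the Frobenius makes the q-th root unique, so
    it inherits the ring laws from the Frobenius. *)
Lemma qroot_zmod_morphism : zmod_morphism (@qroot C q).
Proof. by move=> x y; apply: frob_inj; rewrite rmorphB /= /frob !qrootK. Qed.
HB.instance Definition _ :=
  GRing.isZmodMorphism.Build _ _ (@qroot C q) qroot_zmod_morphism.
Lemma qroot_monoid_morphism : monoid_morphism (@qroot C q).
Proof.
split=> [|x y]; apply: frob_inj; first by rewrite /frob qrootK expr1n.
by rewrite rmorphM /= /frob !qrootK.
Qed.
HB.instance Definition _ :=
  GRing.isMonoidMorphism.Build _ _ (@qroot C q) qroot_monoid_morphism.

(** The ring morphism laws of both maps depend on the characteristic assumption in [HC]. Packing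
    them as abstract morphisms [Fr] and [Fi] lets the later sections twist series by [pser_map] and
    [zser_map], with the ring laws available. *)
Lemma frobenius_exists : exists Fr Fi : {rmorphism C -> C},
  (forall x, Fr x = x ^+ q) /\ (forall x, Fi x = qroot q x).
Proof. by exists frob, (@qroot C q). Qed.
End Frobenius.

(** * Gauss norm, Tate algebra and uniform convergence *)

Variable s : nat.
Implicit Types f g : pser C s.

Lemma gle_ge0 f e : gauss_le abs f e -> 0 <= e.
Proof. by move=> h; apply: le_trans (h [ffun => 0%N]); apply: abs_ge0. Qed.

Lemma gle_weak f e e' : e <= e' -> gauss_le abs f e -> gauss_le abs f e'.
Proof. by move=> he h m; apply: le_trans (h m) he. Qed.

Lemma gle0 e : 0 <= e -> gauss_le abs (0 : pser C s) e.
Proof. by move=> he m; rewrite abs0. Qed.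

Lemma gleD f g e : gauss_le abs f e -> gauss_le abs g e -> gauss_le abs (f + g) e.
Proof. by move=> hf hg m; apply: abs_add. Qed.

Lemma gleN f e : gauss_le abs f e -> gauss_le abs (- f) e.
Proof. by move=> hf m; rewrite coefpN absN. Qed.

Lemma gleB f g e : gauss_le abs f e -> gauss_le abs g e -> gauss_le abs (f - g) e.
Proof. by move=> hf hg; apply: gleD => //; apply: gleN. Qed.

Lemma gle_sum e I (r : seq I) (P : pred I) (F : I -> pser C s) : 0 <= e ->
  (forall i, P i -> gauss_le abs (F i) e) -> gauss_le abs (\sum_(i <- r | P i) F i) e.
Proof. by move=> he h m; rewrite coefp_sum; apply: abs_sum => // i /h. Qed.

Lemma gleM f g a b : gauss_le abs f a -> gauss_le abs g b -> gauss_le abs (f * g) (a * b).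
Proof.
move=> hf hg m; have a0 := gle_ge0 hf; have b0 := gle_ge0 hg.
rewrite coefp_mul; apply: abs_sum => [|k _]; first exact: mulr_ge0.
by rewrite absM ler_pM ?abs_ge0.
Qed.

Lemma gle_const (c : C) : gauss_le abs (@pconst C s c) (abs c).
Proof. by move=> m; rewrite /pconst; case: ifP; rewrite ?abs0 ?abs_ge0. Qed.

Lemma gle_eq0 f : (forall e, 0 < e -> gauss_le abs f e) -> f = 0.
Proof.
move=> h; apply: pserP => m; apply/eqP; rewrite -abs_eq0 eq_le abs_ge0 andbT.
by apply/ler_addgt0Pl => e e0; rewrite addr0; apply: h.
Qed.

Lemma tate_leP f : in_tate abs f <->
  (forall e : R, 0 < e -> exists N, forall m : mi s, (N <= mdeg m)%N -> abs (f m) <= e).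
Proof.
split=> h e e0; first by have [N hN] := h e e0; exists N => m /hN /ltW.
have [|N hN] := h (e / 2); first by rewrite divr_gt0.
by exists N => m /hN hm; apply: le_lt_trans hm _; lra.
Qed.

Lemma tate_bounded f : in_tate abs f -> exists B, 1 <= B /\ gauss_le abs f B.
Proof.
move=> /tate_leP /(_ 1 ltr01) [N hN].
have S0 (r : seq (mi s)) : 0 <= \sum_(k <- r) abs (f k).
  by apply: sumr_ge0 => k _; apply: abs_ge0.
exists (1 + \sum_(k <- mi_box s N) abs (f k)); split; first by rewrite lerDl.
move=> m; have [/hN h|h] := leqP N (mdeg m); first by rewrite ler_wpDr.
rewrite ler_wpDl // (bigD1_seq m) ?mem_mi_box ?mi_box_uniq ?(ltnW h) //=.
by rewrite lerDl sumr_ge0 // => k _; apply: abs_ge0.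
Qed.

Lemma tateD f g : in_tate abs f -> in_tate abs g -> in_tate abs (f + g).
Proof.
move=> /tate_leP hf /tate_leP hg; apply/tate_leP => e e0.
have [[N1 h1] [N2 h2]] := (hf e e0, hg e e0).
exists (maxn N1 N2) => m; rewrite geq_max => /andP[m1 m2].
by apply: abs_add; [apply: h1|apply: h2].
Qed.

Lemma tateN f : in_tate abs f -> in_tate abs (- f).
Proof. by move=> hf e /hf [N h]; exists N => m /h; rewrite coefpN absN. Qed.

Lemma tateB f g : in_tate abs f -> in_tate abs g -> in_tate abs (f - g).
Proof. by move=> hf /tateN; apply: tateD. Qed.

Lemma tate_const (c : C) : in_tate abs (@pconst C s c).
Proof.
move=> e e0; exists 1%N => m hm; rewrite /pconst; case: eqP => [m0|_]; last by rewrite abs0.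
by move: hm; rewrite m0 /mdeg big1 // => i _; rewrite ffunE.
Qed.

Lemma tate0 : in_tate abs (0 : pser C s).
Proof. by move=> e e0; exists 0%N => m _; rewrite abs0. Qed.

Lemma tate_sum I (r : seq I) (P : pred I) (F : I -> pser C s) :
  (forall i, P i -> in_tate abs (F i)) -> in_tate abs (\sum_(i <- r | P i) F i).
Proof. by move=> h; apply: big_ind => //; [apply: tate0|apply: tateD]. Qed.

Lemma tateM f g : in_tate abs f -> in_tate abs g -> in_tate abs (f * g).
Proof.
move=> hf hg; have [Bf [f1 hBf]] := tate_bounded hf; have [Bg [g1 hBg]] := tate_bounded hg.
have f0 : 0 < Bf by apply: lt_le_trans f1. have g0 : 0 < Bg by apply: lt_le_trans g1.
apply/tate_leP => e e0; move/tate_leP: hf => hf; move/tate_leP: hg => hg.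
have [|N1 h1] := hf (e / Bg); first exact: divr_gt0.
have [|N2 h2] := hg (e / Bf); first exact: divr_gt0.
(* If m has degree at least N1 + N2 and k <= m, then k has degree at least N1 or m - k has degree at
   least N2. *)
exists (N1 + N2)%N => m hm; rewrite coefp_mul; apply: abs_sum => [|k hk]; first exact: ltW.
rewrite absM; have [/h1 h|hk1] := leqP N1 (mdeg k).
  by rewrite -(divfK (lt0r_neq0 g0) e) ler_pM ?abs_ge0.
have /h2 h : (N2 <= mdeg (mi_sub m k))%N.
  rewrite -(leq_add2l N1) (leq_trans hm) // -(mdeg_sub hk) leq_add2r; exact: ltnW.
by rewrite mulrC -(divfK (lt0r_neq0 f0) e) ler_pM ?abs_ge0.
Qed.

Lemma tate_lim f :
  (forall e, 0 < e -> exists2 g, in_tate abs g & gauss_le abs (f - g) e) -> in_tate abs f.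
Proof.
move=> h; apply/tate_leP => e e0; have [g /tate_leP hg hfg] := h e e0.
have [N hN] := hg e e0; exists N => m /hN hm.
by rewrite -[f m](subrK (g m)); apply: abs_add => //; apply: hfg.
Qed.

Definition pcvg (u : nat -> pser C s) l := forall e, 0 < e -> exists N0, forall N,
  (N0 <= N)%N -> gauss_le abs (u N - l) e.

Lemma pcvg_tate u l : (forall n, in_tate abs (u n)) -> pcvg u l -> in_tate abs l.
Proof.
move=> hu hl; apply: tate_lim => e /hl [N hN]; exists (u N) => //.
by rewrite -opprB; apply: gleN; apply: hN.
Qed.

Lemma pcvgD u v l l' : pcvg u l -> pcvg v l' -> pcvg (fun n => u n + v n) (l + l').
Proof.
move=> h h' e e0; have [[N hN] [N' hN']] := (h e e0, h' e e0).
exists (maxn N N') => n; rewrite geq_max => /andP[n1 n2].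
by rewrite opprD addrACA; apply: gleD; [apply: hN|apply: hN'].
Qed.

Lemma pcvg_const l : pcvg (fun => l) l.
Proof. by move=> e e0; exists 0%N => n _; rewrite subrr; apply: gle0; apply: ltW. Qed.

Lemma pcvg_sum n (u : nat -> nat -> pser C s) l :
  (forall i, (i < n)%N -> pcvg (u i) (l i)) ->
  pcvg (fun N => \sum_(i < n) u i N) (\sum_(i < n) l i).
Proof.
elim: n => [|n IH] h.
  have -> : (fun N => \sum_(i < 0) u i N) = fun=> 0.
    by apply: funext => N; rewrite big_ord0.
  by rewrite big_ord0; apply: pcvg_const.
have -> : (fun N => \sum_(i < n.+1) u i N) = fun N => (\sum_(i < n) u i N) + u n N.
  by apply: funext => N; rewrite big_ord_recr.
rewrite big_ord_recr; apply: pcvgD; last exact: h.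
by apply: IH => i hi; apply: h; apply: ltnW.
Qed.

Lemma pcvg_shift u l k : pcvg u l -> pcvg (fun n => u (n - k)%N) l.
Proof.
move=> h e /h [N hN]; exists (N + k)%N => n hn; apply: hN.
by rewrite leq_subRL ?(leq_trans (leq_addl _ _) hn) // addnC.
Qed.

Lemma pcvgMl f u l B : gauss_le abs f B -> pcvg u l -> pcvg (fun n => f * u n) (f * l).
Proof.
move=> hf h e e0; have B0 : 0 < B + 1 by rewrite ltr_wpDl // (gle_ge0 hf).
have [|N hN] := h (e / (B + 1)); first exact: divr_gt0.
exists N => n /hN hn; rewrite -mulrBr.
apply: (@gle_weak _ (B * (e / (B + 1)))); last exact: gleM.
by rewrite mulrA ler_pdivrMr // mulrDr mulr1 mulrC lerDl ltW.
Qed.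

Lemma complete_pser (u : nat -> pser C s) :
  (forall e, 0 < e -> exists N, forall n, (N <= n)%N -> gauss_le abs (u n) e) ->
  exists l, pcvg (fun n => \sum_(i < n) u i) l.
Proof.
move=> h; set S := fun n => \sum_(i < n) u i.
have hS e : 0 < e -> exists N, forall m n, (N <= m)%N -> (N <= n)%N ->
    gauss_le abs (S m - S n) e.
  move=> e0; have [N hN] := h e e0; exists N.
  suff H m n : (N <= m)%N -> (m <= n)%N -> gauss_le abs (S n - S m) e.
    move=> m n hm hn; have [mn|/ltnW nm] := leqP m n; last exact: H.
    by rewrite -opprB; apply: gleN; apply: H.
  move=> hm mn; rewrite /S -!(big_mkord xpredT) (big_cat_nat (n := m)) //=.
  rewrite addrAC subrr add0r big_nat; apply: gle_sum => [|i /andP[mi _]]; first exact: ltW.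
  by apply: hN; apply: leq_trans mi.
have hlim m : exists l, forall e, 0 < e -> exists N, forall n, (N <= n)%N ->
    abs (S n m - l) < e.
  case: HC => _ _ _ _ [compl _]; apply: compl => e e0.
  have [|N hN] := hS (e / 2); first by rewrite divr_gt0.
  exists N => a b ha hb; apply: le_lt_trans (hN a b ha hb m) _; lra.
have [l hl] := choice hlim; exists l => e e0.
have [N hN] := hS e e0; exists N => n hn m.
(* [N'] depends on the index m, but it only selects one partial sum to compare with; the bound [N]
   is uniform in m, so the convergence is in the Gauss norm. *)
have [N' hN'] := hl m e e0.
rewrite coefpB -(subrK (S (maxn N N') m) (S n m)) -addrA; apply: abs_add.
  by apply: hN => //; apply: leq_maxl.
by apply/ltW; apply: hN'; apply: leq_maxr.
Qed.

Variables (Fr Fi : {rmorphism C -> C}).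
Hypotheses (FrE : forall x, Fr x = x ^+ q) (FiE : forall x, Fi x = qroot q x).

Lemma FiK : cancel Fi Fr.
Proof. by move=> x; rewrite FrE FiE qrootK. Qed.

Lemma ptw_pos i f : ptw q (Posz i) f = pser_map (iterm Fr i) f.
Proof.
apply: pserP => m; rewrite /ptw /pser_map /= /iterm.
by apply: eq_iter => x; rewrite FrE.
Qed.

Lemma ptw_neg i f : ptw q (- (i%:Z)) f = pser_map (iterm Fi i) f.
Proof.
apply: pserP => m; rewrite /ptw /pser_map /iterm; case: i => [//|i] /=.
by rewrite FiE; congr qroot; apply: eq_iter => x; rewrite FiE.
Qed.

Lemma abs_Fr x : abs (Fr x) = abs x ^+ q.
Proof. by rewrite FrE absX. Qed.

Lemma abs_Fi x : abs (Fi x) ^+ q = abs x.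
Proof. by rewrite -abs_Fr FiK. Qed.

Lemma abs_iterFr i x : abs (iterm Fr i x) = abs x ^+ (q ^ i).
Proof.
by rewrite /iterm; elim: i => [|i IH] //=; rewrite abs_Fr IH -exprM expnSr.
Qed.

Lemma gle_Fr i f e : gauss_le abs f e -> gauss_le abs (pser_map (iterm Fr i) f) (e ^+ (q ^ i)).
Proof.
by move=> h m; rewrite abs_iterFr; apply: lerXn2r; rewrite ?nnegrE ?(gle_ge0 h) ?abs_ge0.
Qed.

Lemma abs_Fr_le x e : abs x <= e -> e <= 1 -> abs (Fr x) <= e.
Proof.
move=> hx e1; rewrite abs_Fr; have := q_gt0; case: q => // n _.
rewrite exprS (le_trans _ hx) // ler_piMr ?abs_ge0 // exprn_ile1 ?abs_ge0 //.
exact: le_trans e1.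
Qed.

Lemma abs_Fi_le x e : 0 <= e -> abs x <= e ^+ q -> abs (Fi x) <= e.
Proof.
by move=> e0; rewrite -abs_Fi => h; rewrite -(@ler_pXn2r _ q) ?nnegrE ?abs_ge0 ?q_gt0.
Qed.

Lemma tate_Fr f : in_tate abs f -> in_tate abs (pser_map Fr f).
Proof.
move=> /tate_leP h; apply/tate_leP => e e0.
(* The q-th power does not increase an absolute value that is at most 1, hence the minimum with
   1. *)
have [|N hN] := h (Num.min e 1); first by rewrite lt_min e0 /=.
exists N => m /hN hm; apply: (@le_trans _ _ (Num.min e 1)); last by rewrite ge_min lexx.
by apply: abs_Fr_le => //; rewrite ge_min lexx orbT.
Qed.

Lemma tate_Fi f : in_tate abs f -> in_tate abs (pser_map Fi f).
Proof.
move=> /tate_leP h; apply/tate_leP => e e0.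
have [|N hN] := h (e ^+ q); first exact: exprn_gt0.
by exists N => m /hN hm; apply: abs_Fi_le => //; apply: ltW.
Qed.

Lemma tate_iter (g : {rmorphism C -> C}) i f :
  (forall f, in_tate abs f -> in_tate abs (pser_map g f)) ->
  in_tate abs f -> in_tate abs (pser_map (iterm g i) f).
Proof.
move=> hg hf; elim: i => [|i IH]; last exact: hg IH.
exact: hf.
Qed.

Lemma pcvg_Fr u l i : pcvg u l ->
  pcvg (fun n => pser_map (iterm Fr i) (u n)) (pser_map (iterm Fr i) l).
Proof.
move=> h e e0; have [|N hN] := h (Num.min e 1); first by rewrite lt_min e0 /=.
exists N => n /hN hn; rewrite -rmorphB; apply: gle_weak (gle_Fr i hn).
set d := Num.min e 1; have d1 : d <= 1 by rewrite ge_min lexx orbT.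
apply: (@le_trans _ _ d); last by rewrite ge_min lexx.
rewrite -[leRHS]expr1; apply: ler_wiXn2l; rewrite // ?expn_gt0 ?q_gt0 //.
exact: gle_ge0 hn.
Qed.

End Cinfty.

(** * The exponential *)

(** Applied with a = r + 1 and b = N + 1: it reconciles the range of the recursion for alpha_N with
    the support of phi_theta. *)
Lemma sum_ord_supp (V : zmodType) (a b : nat) (G : nat -> V) :
  (forall i, (a <= i)%N -> G i = 0) ->
  \sum_(i < a) (if (i < b)%N then G i else 0) = \sum_(i < b) G i.
Proof.
move=> h; rewrite (big_ord_widen (maxn a b) (fun i => if (i < b)%N then G i else 0) (leq_maxl a b)).
rewrite (big_ord_widen (maxn a b) G (leq_maxr a b)).
rewrite big_mkcond [RHS]big_mkcond; apply: eq_bigr => i _.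
by have [ai|ai] := ltnP i a; rewrite // h // if_same.
Qed.

Section Exp.
Variables (R : realType) (C : closedFieldType) (q : nat) (theta : C) (abs : C -> R).
Hypothesis HC : is_Cinfty q theta abs.
Variables (s r : nat) (A : nat -> pser C s).
Hypothesis Hr : (0 < r)%N.
Hypothesis HA : forall i, (1 <= i <= r)%N -> in_tate abs (A i).
Variable Fr : {rmorphism C -> C}.
Hypothesis FrE : forall x, Fr x = x ^+ q.
Variable alpha : tser C s.
Hypothesis Halpha : is_exp q theta r A alpha.

Local Notation tw i := (pser_map (iterm Fr i)).
Local Notation P := (phi_theta theta r A).

Definition phi_act (y : pser C s) : pser C s := \sum_(i < r.+1) P i * tw i y.

Let tw_comp i j (f : pser C s) : tw (i + j) f = tw i (tw j f).
Proof. by apply: pserP => m; rewrite /pser_map /= /iterm iterD. Qed.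

Let q1 : (1 < q)%N := q_gt1 HC.

Lemma phi_coef_tate i : in_tate abs (P i).
Proof.
rewrite /phi_theta; case: eqP => [_|/eqP i0]; first exact: tate_const HC _ _.
by case: ifP => hi; [apply: HA; rewrite lt0n i0|apply: tate0 HC _].
Qed.

Lemma phi_coef_supp i : (r.+1 <= i)%N -> P i = 0.
Proof. by case: i => // i; rewrite /phi_theta ltnNge => /negPf /= ->. Qed.

Lemma phi_coef_bounded : exists M, 1 <= M /\ forall i, gauss_le abs (P i) M.
Proof.
suff [M [M1 hM]] : exists M, 1 <= M /\ forall i, (i < r.+1)%N -> gauss_le abs (P i) M.
  exists M; split=> // i; have [/hM//|/phi_coef_supp ->] := ltnP i r.+1.
  by apply: gle0 HC _ _ _; apply: le_trans M1.
elim: r.+1 => [|n [M [M1 hM]]]; first by exists 1.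
have [B [B1 hB]] := tate_bounded HC (phi_coef_tate n).
exists (Num.max M B); split; first by rewrite le_max M1.
move=> i; rewrite ltnS leq_eqVlt => /orP[/eqP ->|/hM h].
  by apply: gle_weak hB; rewrite le_max lexx orbT.
by apply: gle_weak h; rewrite le_max lexx.
Qed.

Lemma exp_partialE (x : pser C s) N :
  exp_partial q alpha x N = \sum_(i < N) alpha i * tw i x.
Proof.
transitivity (\sum_(i < N) alpha i * ptw q (Posz i) x) => //.
by apply: eq_bigr => i _; rewrite (ptw_pos FrE).
Qed.

(** This compares the coefficients of tau^n in exp_phi theta = phi_theta exp_phi; on the left only
    alpha_n tau^n theta = alpha_n theta^(q^n) tau^n contributes. *)
Lemma exp_rec n :
  alpha n * @pconst C s (iterm Fr n theta) = \sum_(i < n.+1) P i * tw i (alpha (n - i)%N).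
Proof.
have [_ h] := Halpha; have {}h : tsmul q alpha (@theta_ts C s theta) n = tsmul q P alpha n.
  by apply: pserP => m; apply: h.
have -> : \sum_(i < n.+1) P i * tw i (alpha (n - i)%N) = tsmul q P alpha n.
  transitivity (\sum_(i < n.+1) P i * ptw q (Posz i) (alpha (n - i)%N)) => //.
  by apply: eq_bigr => i _; rewrite (ptw_pos FrE).
rewrite -h.
transitivity (\sum_(i < n.+1) alpha i * ptw q (Posz i) (@theta_ts C s theta (n - i)%N)) => //.
rewrite big_ord_recr /= subnn [theta_ts _ 0]/(pconst theta) (ptw_pos FrE).
rewrite pser_map_const big1 ?add0r // => i _.
rewrite (ptw_pos FrE) /theta_ts subn_eq0 leqNgt ltn_ord /=.
by rewrite [X in _ * X](_ : _ = 0) ?mulr0 //; apply: rmorph0.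
Qed.

(** Carlitz's bracket [n] = theta^(q^n) - theta. It multiplies alpha_n once the term theta alpha_n
    of [exp_rec] is moved to the left. *)
Let D n := iterm Fr n theta - theta.

(** Since |theta^(q^n)| = q^(q^n) exceeds |theta|, the ultrametric inequality for the difference is
    an equality. *)
Let abs_D n : (0 < n)%N -> abs (D n) = q%:R ^+ (q ^ n).
Proof.
move=> n0; have hq : 1 < (q%:R : R) by rewrite ltr1n.
have e : abs (iterm Fr n theta) = q%:R ^+ (q ^ n).
  by rewrite (abs_iterFr HC FrE) (abs_theta HC).
have lt1 : abs theta < abs (iterm Fr n theta).
  by rewrite e (abs_theta HC) -[ltLHS]expr1 ltr_eXn2l // -(exp1n n) ltn_exp2r.
apply/eqP; rewrite eq_le -e; apply/andP; split.
  by apply: abs_sub HC _ _ _ _ _; rewrite // ltW.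
rewrite leNgt; apply/negP => h.
have : abs (iterm Fr n theta) <= Num.max (abs (D n)) (abs theta).
  by rewrite -{1}(subrK theta (iterm Fr n theta)); apply: abs_add HC _ _ _ _ _;
    rewrite le_max lexx ?orbT.
by rewrite leNgt gt_max h lt1.
Qed.

Lemma exp_rec_pos n : (0 < n)%N ->
  @pconst C s (D n) * alpha n = \sum_(i < n) P i.+1 * tw i.+1 (alpha (n - i.+1)%N).
Proof.
move=> n0; have := exp_rec n; rewrite big_ord_recl /= subn0.
have -> : tw 0 (alpha n) = alpha n by [].
move=> e; have -> : @pconst C s (D n) = pconst (iterm Fr n theta) - pconst theta.
  by apply: pserP => m; rewrite coefpB /pconst; case: ifP; rewrite ?subrr.
rewrite mulrBl mulrC e [P 0]/(pconst theta) addrAC subrr add0r.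
by apply: eq_bigr.
Qed.

Let D_neq0 n : (0 < n)%N -> D n != 0.
Proof.
move=> n0; rewrite -(abs_eq0 HC) abs_D // expf_neq0 // pnatr_eq0.
by case: q q1.
Qed.

Lemma exp_coef_tate n : in_tate abs (alpha n).
Proof.
elim/ltn_ind: n => -[_|n IH]; first by have [-> _] := Halpha; apply: tate_const HC _ _.
have -> : alpha n.+1 = @pconst C s (D n.+1)^-1 * (@pconst C s (D n.+1) * alpha n.+1).
  by apply: pserP => m; rewrite !coefp_const mulKf // D_neq0.
apply: (tateM HC); first exact: tate_const HC _ _.
rewrite exp_rec_pos //; apply: (tate_sum HC) => i _.
apply: (tateM HC); first exact: phi_coef_tate.
by apply: (tate_iter _ (tate_Fr HC FrE)); apply: IH; rewrite subSS ltnS leq_subr.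
Qed.

(** * Growth of the coefficients and local inversion of the exponential *)

Variable M : R.
Hypotheses (M1 : 1 <= M) (HM : forall i, gauss_le abs (P i) M).

Let M0 : 0 < M. Proof. exact: lt_le_trans M1. Qed.
Let qR : 1 < (q%:R : R). Proof. by rewrite ltr1n. Qed.
Let qR0 : 0 < (q%:R : R). Proof. exact: lt_trans qR. Qed.

(** The division by [M] is what absorbs the factor [M] coming from a coefficient of phi_theta: the
    claim reduces to M^2 <= M^(q^b), true because M >= 1 and q^b >= 2. *)
Let bound_step (x : R) a b : 0 <= x -> (0 < b)%N ->
  M * (x ^+ (q ^ a) / M) ^+ (q ^ b) <= x ^+ (q ^ (a + b)) / M.
Proof.
move=> x0 b0; rewrite expr_div_n -exprM -expnD mulrCA.
apply: ler_wpM2l; first exact: exprn_ge0.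
rewrite ler_pdivrMr ?exprn_gt0 // mulrC ler_pdivlMr // -expr2.
apply: ler_weXn2l => //; apply: (leq_trans q1).
by rewrite -{1}(expn1 q) leq_exp2l.
Qed.

(* The size of the n-th coefficient is governed by the recursion
   [b_n <= max (b_(n-1), .., b_(n-r)) / q] for [b_n := (M |alpha_n|) ^ (1 / q ^ n)]. *)
Lemma exp_coef_bound n j : (j * r <= n)%N ->
  gauss_le abs (alpha n) ((M / q%:R ^+ j) ^+ (q ^ n) / M).
Proof.
elim/ltn_ind: n j => -[_|n IH] j hj.
  have [-> _] := Halpha; move: hj; rewrite leqn0 muln_eq0 (gtn_eqF Hr) orbF => /eqP ->.
  rewrite !expr0 !expn0 divr1 expr1 divff ?lt0r_neq0 //.
  by have := gle_const HC (s := s) (1 : C); rewrite (abs1 HC).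
set e := (M / q%:R ^+ j.-1) ^+ (q ^ n.+1) / M.
have e0 : 0 <= e by rewrite divr_ge0 ?exprn_ge0 ?divr_ge0 ?exprn_ge0 // ltW.
have h : gauss_le abs (@pconst C s (D n.+1) * alpha n.+1) e.
  rewrite exp_rec_pos //; apply: (gle_sum HC) => // i _.
  have [ir|ri] := leqP i.+1 r; last first.
    by rewrite phi_coef_supp // mul0r; apply: (gle0 HC).
  have hI : gauss_le abs (alpha (n - i)%N) ((M / q%:R ^+ j.-1) ^+ (q ^ (n - i)) / M).
    apply: IH; first by rewrite ltnS leq_subr.
    case: j hj {e e0} => //= j; rewrite mulSn => hj.
    rewrite leq_subRL; last by rewrite -ltnS.
    rewrite -ltnS (leq_trans _ hj) // -addSn leq_add2r //.
  rewrite subSS; apply: gle_weak (gleM HC (HM i.+1) (gle_Fr HC FrE i.+1 hI)).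
  have := @bound_step (M / q%:R ^+ j.-1) (n - i) i.+1.
  have hin : (i <= n)%N by rewrite -ltnS.
  rewrite addnS subnK //; apply=> //.
  by rewrite divr_ge0 ?exprn_ge0 // ltW.
(* Dividing by q^(q^(n+1)) replaces M / q^(j.-1) by M / q^(j.-1 + 1). The new exponent is j, except
   for j = 0, where the bound obtained is better than the one claimed. *)
move=> m; have := h m; rewrite coefp_const (absM HC) abs_D //.
rewrite mulrC -ler_pdivlMr ?exprn_gt0 // => hm; apply: (le_trans hm).
rewrite /e mulrAC -expr_div_n ler_pM2r ?invr_gt0 //.
apply: lerXn2r; rewrite ?nnegrE ?divr_ge0 ?exprn_ge0 ?(ltW M0) ?(ltW qR0) //.
rewrite -mulrA -invfM ler_pM2l // -exprSr lef_pV2 ?posrE ?exprn_gt0 //.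
by apply: ler_weXn2l; [exact: ltW|case: (j)].
Qed.

Let le_exp2 (x : R) : exists j, x <= 2 ^+ j.
Proof.
have := archi_boundP (normr_ge0 x); set k := Num.bound _ => hk; exists k.
apply: (le_trans (ler_norm x)); apply: (le_trans (ltW hk)).
by rewrite -natrX ler_nat ltnW // ltn_expl.
Qed.

Let le_expq (x : R) : exists j, x <= q%:R ^+ j.
Proof.
have [j hj] := le_exp2 x; exists j; apply: (le_trans hj).
by apply: lerXn2r; rewrite ?nnegrE ?ler0n // ler_nat.
Qed.

(** The graph of exp_phi. As a relation it records convergence together with the value. *)
Definition exp_rel (x y : pser C s) :=
  pcvg abs (fun N => \sum_(i < N) alpha i * tw i x) y.

Lemma exp_term_small (x : pser C s) B : gauss_le abs x B ->
  forall e, 0 < e -> exists N, forall n, (N <= n)%N -> gauss_le abs (alpha n * tw n x) e.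
Proof.
move=> hx e e0; have B0 := gle_ge0 HC hx.
(* [j] makes the base M B / q^j at most 1/q. Since q^n >= n >= N, its power of exponent q^n is then
   at most q^(-N) <= e. *)
have [j hj] := le_expq (M * B * q%:R); have [N hN] := le_expq e^-1.
exists (maxn (j * r) N) => n; rewrite geq_max => /andP[jn Nn].
apply: gle_weak (gleM HC (exp_coef_bound jn) (gle_Fr HC FrE n hx)).
have X0 : 0 <= (M / q%:R ^+ j) ^+ (q ^ n) by rewrite exprn_ge0 // divr_ge0 ?exprn_ge0 // ltW.
apply: (@le_trans _ _ ((M / q%:R ^+ j) ^+ (q ^ n) * B ^+ (q ^ n))).
  by rewrite ler_wpM2r ?exprn_ge0 // ler_pdivrMr // ler_peMr.
rewrite -exprMn; apply: (@le_trans _ _ (q%:R^-1 ^+ (q ^ n))).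
  apply: lerXn2r; rewrite ?nnegrE ?invr_ge0 ?ler0n //.
    by rewrite mulr_ge0 // divr_ge0 ?exprn_ge0 // ltW.
  by rewrite mulrAC ler_pdivrMr ?exprn_gt0 // [leRHS]mulrC ler_pdivlMr.
apply: (@le_trans _ _ (q%:R^-1 ^+ N)).
  apply: ler_wiXn2l; rewrite ?invr_ge0 ?invf_le1 // ?ltW //.
  by apply: (leq_trans Nn); apply/ltnW/ltn_expl.
by rewrite exprVn -[leRHS]invrK lef_pV2 ?posrE ?exprn_gt0 ?invr_gt0.
Qed.

Lemma exp_exists (x : pser C s) : in_tate abs x -> exists y, in_tate abs y /\ exp_rel x y.
Proof.
move=> hx; have [B [_ hB]] := tate_bounded HC hx.
have [y hy] := complete_pser HC (exp_term_small hB); exists y; split=> //.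
apply: (pcvg_tate HC) hy => n; apply: (tate_sum HC) => i _.
apply: (tateM HC); first exact: exp_coef_tate.
exact: (tate_iter _ (tate_Fr HC FrE)).
Qed.

Lemma exp_relD x y x' y' : exp_rel x y -> exp_rel x' y' -> exp_rel (x + x') (y + y').
Proof.
move=> h h'; have := pcvgD HC h h'; rewrite /exp_rel.
congr pcvg; apply: funext => N; rewrite -big_split /=; apply: eq_bigr => i _.
by rewrite rmorphD mulrDr.
Qed.

Lemma exp_relN x y : exp_rel x y -> exp_rel (- x) (- y).
Proof.
move=> h e /h [N hN]; exists N => n /hN hn; rewrite -[X in gauss_le _ X](opprK) opprD.
apply: (gleN HC); rewrite opprK; congr gauss_le: hn; congr (_ - _).
by rewrite -sumrN; apply: eq_bigr => i _; rewrite rmorphN mulrN opprK.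
Qed.

(** By [exp_coef_bound] with j = 0, each term of index n >= 1 is at most (M d)^(q^n) / M <= (M d)^2
    / M <= d / 2. *)
Lemma exp_near_id x y d : gauss_le abs x d -> M * d <= 2^-1 -> exp_rel x y ->
  gauss_le abs (y - x) (d / 2).
Proof.
move=> hx hd hy; have d0 := gle_ge0 HC hx.
have S_near N : gauss_le abs (\sum_(i < N.+1) alpha i * tw i x - x) (d / 2).
  rewrite big_ord_recl /=; have [-> _] := Halpha.
  have -> : pconst 1 * tw 0 x = x by rewrite [pconst 1]/(1 : pser C s) mul1r.
  rewrite addrAC subrr add0r; apply: (gle_sum HC); first by rewrite divr_ge0.
  move=> i _; have := @exp_coef_bound i.+1 0; rewrite expr0 divr1 => /(_ isT) hi.
  apply: gle_weak (gleM HC hi (gle_Fr HC FrE i.+1 hx)).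
  rewrite mulrAC -exprMn ler_pdivrMr //.
  have Md0 : 0 <= M * d by rewrite mulr_ge0 // ltW.
  apply: (@le_trans _ _ ((M * d) ^+ 2)).
    apply: ler_wiXn2l => //; first by lra.
    by apply: (leq_trans q1); rewrite -{1}(expn1 q) leq_exp2l.
  by apply: le_trans (ler_wpM2l Md0 hd) _; rewrite [leRHS]mulrAC [M * d]mulrC.
move=> m; apply/ler_addgt0Pr => e e0; have [N hN] := hy e e0.
have -> : y - x = (\sum_(i < N.+1) alpha i * tw i x - x) - (\sum_(i < N.+1) alpha i * tw i x - y).
  by rewrite opprB [RHS]addrC addrA subrK.
apply: (abs_sub HC).
  by apply: (le_trans (S_near N m)); rewrite lerDl ltW.
by apply: (le_trans (hN N.+1 (leqnSn N) m)); rewrite lerDr divr_ge0.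
Qed.

(** Successive approximation: u_k is the error f - exp_phi(u_0 + .. + u_(k-1)). By [exp_near_id] its
    bound is halved at each step, so the preimage is the sum of all u_k. *)
Lemma exp_surj_small f d : in_tate abs f -> 0 < d -> gauss_le abs f d -> M * d <= 2^-1 ->
  exists x, in_tate abs x /\ exp_rel x f.
Proof.
move=> tf d0 hf hd.
(* Choice needs a total function; outside T_s the value is a dummy 0, which is harmless because
   every u_k and their sum lie in T_s. *)
have hex x : exists y, in_tate abs x -> in_tate abs y /\ exp_rel x y.
  have [tx|ntx] := pselect (in_tate abs x); last by exists 0.
  by have [y hy] := exp_exists tx; exists y.
have [E hE] := choice hex.
pose u := fix u k := if k is k'.+1 then u k' - E (u k') else f.
have tu k : in_tate abs (u k).
  elim: k => //= k IH; apply: (tateB HC) => //; by case: (hE _ IH).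
have half_le k : d / 2 ^+ k <= d.
  rewrite ler_pdivrMr ?exprn_gt0 ?ltr0n // ler_peMr ?(ltW d0) // exprn_ege1 //.
  by rewrite ler1n.
have Md c : c <= d -> M * c <= 2^-1.
  by move=> h; apply: le_trans hd; rewrite ler_pM2l.
have hu : forall k, gauss_le abs (u k) (d / 2 ^+ k).
  elim=> [|k IH]; first by rewrite expr0 divr1.
  rewrite /= -opprB exprSr invfM mulrA; apply: (gleN HC).
  by apply: (exp_near_id IH); [apply: Md|case: (hE _ (tu k))].
have usmall e : 0 < e -> exists N, forall n, (N <= n)%N -> gauss_le abs (u n) e.
  move=> e0; have [N hN] := le_exp2 (d / e); exists N => n Nn.
  apply: gle_weak (hu n); rewrite ler_pdivrMr ?exprn_gt0 //.
  rewrite mulrC -ler_pdivrMr //; apply: (le_trans hN).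
  by apply: ler_weXn2l => //; lra.
have [x hx] := complete_pser HC usmall.
have tx : in_tate abs x.
  by apply: (pcvg_tate HC) hx => n; apply: (tate_sum HC) => i _.
exists x; split=> //; have [_ hEx] := hE _ tx.
suff <- : E x = f by [].
have hS n : exp_rel (\sum_(i < n) u i) (f - u n).
  elim: n => [|n IH].
    rewrite big_ord0 subrr /exp_rel (_ : (fun N => _) = fun=> 0); first exact: pcvg_const HC _ _.
    by apply: funext => N; rewrite big1 // => i _; rewrite rmorph0 mulr0.
  rewrite big_ord_recr /=.
  have -> : f - (u n - E (u n)) = (f - u n) + E (u n) by rewrite opprB addrA addrAC.
  by apply: exp_relD => //; case: (hE _ (tu n)).
apply/eqP; rewrite -subr_eq0; apply/eqP; apply: (gle_eq0 HC) => e e0.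
(* With S_n the n-th partial sum, additivity gives exp_phi(x - S_n) = E x - f + u_n, and both x -
   S_n and u_n are small for large n. The minimum with [d] keeps x - S_n in the ball where
   [exp_near_id] applies. *)
pose e' := Num.min e d.
have e'0 : 0 < e' by rewrite lt_min e0.
have [e'e e'd] : e' <= e /\ e' <= d by rewrite !ge_min !lexx orbT.
have [N1 h1] := hx e' e'0; have [N2 h2] := usmall e e0.
pose n := maxn N1 N2.
have hxS : gauss_le abs (x - \sum_(i < n) u i) e'.
  by rewrite -opprB; apply: (gleN HC); apply: h1; apply: leq_maxl.
have := exp_near_id hxS (Md _ e'd) (exp_relD hEx (exp_relN (hS n))).
set S := \sum_(i < n) u i => hn.
have -> : E x - f = (E x + - (f - u n) - (x - S)) + ((x - S) - u n).
  by rewrite [RHS]addrA subrK opprB addrCA [RHS]addrAC subrr add0r.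
apply: (gleD HC).
  by apply: gle_weak hn; apply: le_trans e'e; lra.
apply: (gleB HC); first exact: gle_weak hxS.
by apply: h2; apply: leq_maxr.
Qed.

Lemma exp_rel_theta x y : exp_rel x y -> exp_rel (@pconst C s theta * x) (phi_act y).
Proof.
move=> h; set S := fun N => \sum_(i < N) alpha i * tw i x.
(* This is exp_phi theta = phi_theta exp_phi truncated at order N: tau^i raises the order by i, so
   only N - i terms of the inner sum survive, none when i >= N. The shift by i does not change the
   limit. *)
have SE N : \sum_(i < N) alpha i * tw i (@pconst C s theta * x) =
    \sum_(i < r.+1) P i * tw i (S (N - i)%N).
  elim: N => [|N IH].
    rewrite big_ord0 big1 // => i _.
    by rewrite sub0n /S big_ord0 rmorph0 mulr0.
  rewrite big_ord_recr /= IH rmorphM /= pser_map_const mulrA exp_rec mulr_suml.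
  transitivity (\sum_(i < r.+1) P i * tw i (S (N - i)%N) +
     \sum_(i < r.+1) if (i < N.+1)%N then P i * tw i (alpha (N - i)%N * tw (N - i) x) else 0).
    congr (_ + _).
    rewrite (sum_ord_supp _ (G := fun i => P i * tw i (alpha (N - i)%N * tw (N - i) x))).
      apply: eq_bigr => i _; rewrite rmorphM /= -tw_comp subnKC ?mulrA //.
      by rewrite -ltnS.
    by move=> i hi; rewrite phi_coef_supp ?mul0r.
  rewrite -big_split; apply: eq_bigr => i _ /=.
  case: ifP => hi; last by rewrite addr0; move/negbT: hi; rewrite -leqNgt -!subn_eq0 => hi;
     rewrite (eqP hi); rewrite subn_eq0 in hi; move/eqP: (ltnW hi) => ->.
  by rewrite subSn // -mulrDr -rmorphD /S big_ord_recr.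
rewrite /exp_rel (_ : (fun N => _) = fun N => \sum_(i < r.+1) P i * tw i (S (N - i)%N)).
  apply: (pcvg_sum HC (u := fun i N => P i * tw i (S (N - i)%N))
     (l := fun i => P i * tw i y)) => i _.
  apply: (pcvgMl HC (HM i)); apply: (pcvg_Fr HC FrE).
  exact: (pcvg_shift (l := y) i h).
by apply: funext.
Qed.

Lemma exp_surj_tower (xi : pser C s) (f : nat -> pser C s) :
  (forall n, in_tate abs (f n)) -> phi_act (f 0%N) = xi ->
  (forall n, phi_act (f n.+1) = f n) ->
  (forall e, 0 < e -> exists n, gauss_le abs (f n) e) ->
  exists x, in_tate abs x /\ exp_rel x xi.
Proof.
(* The largest radius with M d <= 1/2, as [exp_surj_small] demands. *)
move=> hf f0 fS fsmall; pose d : R := (2 * M)^-1.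
have d0 : 0 < d by rewrite invr_gt0 mulr_gt0.
have [n hn] := fsmall d d0.
have [|x [tx hx]] := exp_surj_small (hf n) d0 hn.
  by rewrite /d invfM mulrCA divff ?mulr1 // lt0r_neq0.
have step z w : in_tate abs z /\ exp_rel z w ->
    exists z', in_tate abs z' /\ exp_rel z' (phi_act w).
  move=> [tz hz]; exists (pconst theta * z); split; last exact: exp_rel_theta.
  by apply: (tateM HC) => //; apply: tate_const HC _ _.
elim: n x tx hx {hn} => [|n IH] x tx hx.
  by rewrite -f0; apply: (step x).
have [|z [tz hz]] := step x (f n.+1); first by split.
by apply: (IH z tz); rewrite -fS.
Qed.

End Exp.

(** * The difference equation attached to the trivialization *)

Section TateSeries.
Variables (R : realType) (C : closedFieldType) (q : nat) (theta : C) (abs : C -> R).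
Hypothesis HC : is_Cinfty q theta abs.
Variables (s : nat) (Fr Fi : {rmorphism C -> C}).
Hypotheses (FrE : forall x, Fr x = x ^+ q) (FiE : forall x, Fi x = qroot q x).
Implicit Types a b : zser C s.

(* The ring T_s{z} of series converging for |z| <= 1; the larger radius of
   T_s{z/theta} plays no role. *)
Definition in_tz a := (forall i, in_tate abs (a i)) /\
  (forall e : R, 0 < e -> exists N, forall i, (N <= i)%N -> gauss_le abs (a i) e).

Lemma in_tate_z_tz a : in_tate_z abs q a -> in_tz a.
Proof.
move=> [ta ha]; split=> // e /ha [N hN]; exists N => i /hN hi m.
apply: le_trans (hi m); rewrite ler_peMl ?(abs_ge0 HC) // exprn_ege1 //.
by rewrite ler1n (q_gt0 HC).
Qed.

Lemma tz_bounded a : in_tz a -> exists B, 1 <= B /\ forall i, gauss_le abs (a i) B.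
Proof.
move=> [ta ha]; have [N hN] := ha 1 ltr01.
suff [B [B1 hB]] : exists B, 1 <= B /\ forall i, (i < N)%N -> gauss_le abs (a i) B.
  exists B; split=> // i; have [/hB//|Ni] := ltnP i N.
  exact: gle_weak (hN _ Ni).
elim: N {hN} => [|n [B [B1 hB]]]; first by exists 1.
have [B' [B'1 hB']] := tate_bounded HC (ta n).
exists (Num.max B B'); split; first by rewrite le_max B1.
move=> i; rewrite ltnS leq_eqVlt => /orP[/eqP ->|/hB h].
  by apply: gle_weak hB'; rewrite le_max lexx orbT.
by apply: gle_weak h; rewrite le_max lexx.
Qed.

Lemma tzD a b : in_tz a -> in_tz b -> in_tz (a + b).
Proof.
move=> [ta ha] [tb hb]; split=> [i|e e0]; first exact: (tateD HC (ta i) (tb i)).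
have [[N1 h1] [N2 h2]] := (ha e e0, hb e e0).
exists (maxn N1 N2) => i; rewrite geq_max => /andP[i1 i2].
by apply: (gleD HC); [apply: h1|apply: h2].
Qed.

Lemma tz_const f : in_tate abs f -> in_tz (zconst f).
Proof.
move=> tf; split=> [i|e e0].
  by rewrite /zconst; case: ifP => _ //; apply: (tate0 HC).
by exists 1%N => -[//|i] _; apply: (gle0 HC); apply: ltW.
Qed.

Lemma tz_sum I (P : pred I) (l : seq I) (F : I -> zser C s) :
  (forall i, P i -> in_tz (F i)) -> in_tz (\sum_(i <- l | P i) F i).
Proof.
move=> h; apply: big_ind => //; last exact: tzD.
split=> [i|e e0]; first exact: (tate0 HC).
by exists 0%N => i _; apply: (gle0 HC); apply: ltW.
Qed.

Lemma tzM a b : in_tz a -> in_tz b -> in_tz (a * b).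
Proof.
move=> Ha Hb; have [Ba [a1 hBa]] := tz_bounded Ha; have [Bb [b1 hBb]] := tz_bounded Hb.
move: Ha Hb => [ta ha] [tb hb].
have a0 : 0 < Ba by apply: lt_le_trans a1. have b0 : 0 < Bb by apply: lt_le_trans b1.
split=> [i|e e0].
  by rewrite coefz_mul; apply: (tate_sum HC) => k _; apply: (tateM HC).
have [|N1 h1] := ha (e / Bb); first exact: divr_gt0.
have [|N2 h2] := hb (e / Ba); first exact: divr_gt0.
exists (N1 + N2)%N => n hn; rewrite coefz_mul; apply: (gle_sum HC) => [|k _]; first exact: ltW.
have [/h1 h|hk1] := leqP N1 k.
  by rewrite -(divfK (lt0r_neq0 b0) e); apply: (gleM HC).
have /h2 h : (N2 <= n - k)%N.
  rewrite leq_subRL; last by rewrite -ltnS.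
  by apply: leq_trans hn; rewrite leq_add2r ltnW.
by rewrite -(divfK (lt0r_neq0 a0) e) mulrC; apply: (gleM HC).
Qed.

Lemma tz_Fi a : in_tz a -> in_tz (zser_map Fi a).
Proof.
move=> [ta ha]; split=> [i|e e0]; first exact: (tate_Fi HC FrE FiE).
have [|N hN] := ha (e ^+ q); first exact: exprn_gt0.
by exists N => i /hN hi m; apply: (abs_Fi_le HC FrE FiE); [apply: ltW|apply: hi].
Qed.

(** The root is chosen separately for each coefficient. The smallness clause of [artin_schreier]
    transfers the decay in t_1, .., t_s and the decay in z from [a] to the solution. *)
Lemma tz_artin_schreier a : in_tz a -> exists h, in_tz h /\ zser_map Fr h = h + a.
Proof.
move=> [ta ha]; have [g hg] := choice (artin_schreier HC).
have small c e : abs c <= e -> e < 1 -> abs (g c) <= e.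
  by move=> ce e1; have [_ /(_ (le_lt_trans ce e1)) h] := hg c; apply: le_trans ce.
(* The cap 1/2 ensures that the bound is below 1, where the small root is available. *)
have halfmin e : 0 < e -> let e' := Num.min e (2^-1 : R) in [/\ 0 < e', e' <= e & e' < 1].
  move=> e0 e'; split; first by rewrite lt_min e0 invr_gt0 ltr0n.
    by rewrite ge_min lexx.
  by apply: (@le_lt_trans _ _ 2^-1); [rewrite ge_min lexx orbT|lra].
exists (fun n m => g (a n m)); split; last first.
  apply: funext => n; apply: pserP => m; rewrite coefzD coefpD /zser_map /pser_map FrE.
  by have [e _] := hg (a n m); rewrite -[X in _ = _ + X]e addrC subrK.
split=> [i|e /halfmin [e'0 e'e e'1]].
  apply/tate_leP => e /halfmin [e'0 e'e e'1].
  have [N hN] := (tate_leP _ _).1 (ta i) _ e'0; exists N => m /hN hm.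
  by apply: le_trans e'e; apply: small.
have [N hN] := ha _ e'0; exists N => i /hN hi m.
by apply: le_trans e'e; apply: small (hi m) _.
Qed.

Lemma zmap_FiK : cancel (zser_map Fi) (@zser_map C s Fr).
Proof.
by move=> a; apply: funext => n; apply: pserP => m; rewrite /zser_map /pser_map (FiK HC FrE FiE).
Qed.

Lemma iter_FiK i : cancel (pser_map (iterm Fi i)) (@pser_map C s (iterm Fr i)).
Proof.
move=> f; apply: pserP => m; rewrite /pser_map /= /iterm.
elim: i (f m) => [//|i IH] x; rewrite iterSr [iter i.+1 Fi x]iterS.
by rewrite (FiK HC FrE FiE) IH.
Qed.

End TateSeries.

(** * Variation of constants; the rank is written r + 1 from here on *)

Section DifferenceEquation.
Variables (R : realType) (C : closedFieldType) (q : nat) (theta : C) (abs : C -> R).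
Hypothesis HC : is_Cinfty q theta abs.
Variables (s : nat) (Fr Fi : {rmorphism C -> C}).
Hypotheses (FrE : forall x, Fr x = x ^+ q) (FiE : forall x, Fi x = qroot q x).
Variables (r : nat) (A : nat -> pser C s) (Binv : pser C s).
Hypothesis HB : in_tate abs Binv.
Hypothesis HAr : A r.+1 * Binv = 1.

Local Notation T i := (zser_map (iterm Fr i)).
Local Notation S i := (pser_map (iterm Fi i)).
Local Notation P := (phi_theta theta r.+1 A).
Local Notation Br := (S r.+1 Binv).

Let zconstN f : zconst (- f) = - zconst f :> zser C s.
Proof. by apply: funext => -[|n]; rewrite coefzN //= oppr0. Qed.
Let zconstM f g : zconst (f * g) = zconst f * zconst g :> zser C s.
Proof. by apply: funext => -[|n]; rewrite coefz_const //= mulr0. Qed.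

Let T_iter i j (a : zser C s) : T (i + j) a = T i (T j a).
Proof.
apply: funext => n; apply: pserP => m.
by rewrite /zser_map /pser_map /= /iterm iterD.
Qed.

(* Apply [T j] to the j-th equation of [y^(1) = y Phi + xi e_1] and add up: with
   [u = y_r / A_r^(-r)] the system becomes [phi_theta u = z u + xi]. *)
Lemma telescope_system (y : nat -> zser C s) (u : zser C s) (xi : pser C s) :
  u = y r * zconst Br ->
  zser_map Fr (y 0%N) = u * (@zX C s - zconst (pconst theta)) + zconst xi ->
  (forall j, (j < r)%N ->
    zser_map Fr (y j.+1) = y j - u * zconst (S j.+1 (A j.+1))) ->
  \sum_(i < r.+2) zconst (P i) * T i u = @zX C s * u + zconst xi.
Proof.
move=> uE E0 ES.
have H k : (k <= r)%N -> T k.+1 (y k) =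
    zser_map Fr (y 0%N) - \sum_(i < k) zconst (A i.+1) * T i.+1 u.
  elim: k => [|k IH] kr; first by rewrite big_ord0 subr0.
  rewrite -addn1 T_iter [T 1 _]ES // rmorphB /= rmorphM /= IH ?(ltnW kr) //.
  rewrite zser_map_const (iter_FiK HC FrE FiE) big_ord_recr /= opprD addrA.
  by congr (_ - _); rewrite mulrC.
(* [T r.+1] turns [Br] back into [Binv], the inverse of the leading coefficient, so the last unknown
   closes the telescope with the leading term of phi_theta. *)
have yr : T r.+1 (y r) = zconst (A r.+1) * T r.+1 u.
  rewrite uE rmorphM /= zser_map_const (iter_FiK HC FrE FiE).
  by rewrite mulrCA -zconstM HAr [zconst 1]/(1 : zser C s) mulr1.
have := H r (leqnn r); rewrite yr => /eqP; rewrite eq_sym subr_eq => /eqP e.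
rewrite big_ord_recl /= [P 0]/(pconst theta) (_ : T 0 u = u) //.
have -> : \sum_(i < r.+1) zconst (P (bump 0 i)) * T (bump 0 i) u = zser_map Fr (y 0%N).
  rewrite e big_ord_recr addrC; congr (_ + _).
    by apply: eq_bigr => i _; rewrite /bump leq0n add1n /phi_theta /= ltnS ltnW.
  by rewrite /bump leq0n add1n /phi_theta /= leqnn.
rewrite E0 addrA; congr (_ + _).
by rewrite mulrBr [X in X + _]mulrC addrC subrK mulrC.
Qed.

Lemma division_tower (Psi : zmx C s r.+1)
  (HPsi : rigid_analytic_trivialization abs q theta A Binv Psi)
  (xi : pser C s) : in_tate abs xi ->
  exists f : nat -> pser C s,
  [/\ forall n, in_tate abs (f n), phi_act theta r.+1 A Fr (f 0%N) = xi,
      forall n, phi_act theta r.+1 A Fr (f n.+1) = f n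
    & forall e, 0 < e -> exists n, gauss_le abs (f n) e].
Proof.
move=> txi; case: HPsi => tPsi [Psi' [tPsi' [PP' P'P]]] HPhi.
pose M (N : zmx C s r.+1) : 'M[zser C s]_r.+1 := \matrix_(i, j) N i j.
have M_mul N N' : M (zmx_mul N N') = M N *m M N'.
  apply/matrixP => i j; rewrite !mxE.
  by transitivity (\sum_k (N i k : zser C s) * N' k j) => //; apply: eq_bigr => k _; rewrite !mxE.
have M_eq N N' : zmx_eq N N' -> M N = M N'.
  move=> h; apply/matrixP => i j; rewrite !mxE.
  by apply: funext => n; apply: pserP => m; apply: h.
have M_one : M (@zmx_one C s r.+1) = 1%:M.
  by apply/matrixP => i j; rewrite !mxE /zmx_one; case: (i == j).
have e1 : M Psi *m M Psi' = 1%:M by rewrite -M_mul -M_one; apply: M_eq.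
have e2 : M Psi' *m M Psi = 1%:M by rewrite -M_mul -M_one; apply: M_eq.
set F := Phi q theta A Binv in HPhi.
have e3 : map_mx (zser_map Fi) (M Psi) = M F *m M Psi.
  rewrite -M_mul -(M_eq _ _ HPhi); apply/matrixP => i j; rewrite !mxE /zmx_tw.
  by apply: funext => n; rewrite /ztw /zser_map (ptw_neg FiE 1).
have hex j : exists h, in_tz abs h /\ zser_map Fr h = h + zconst xi * Psi ord0 j.
  apply: (tz_artin_schreier HC FrE); apply: (tzM HC); first exact: (tz_const HC).
  exact: (in_tate_z_tz HC).
have [h hP] := choice hex.
pose H : 'rV[zser C s]_r.+1 := \row_j h j.
(* Variation of constants, with ^(-1) the twist and e_1 the first basis row. By construction Y
   Psi^(-1) = H and H^(1) = H + xi e_1 Psi. Hence Y^(1) Psi = H^(1) = Y Psi^(-1) + xi e_1 Psi = (Y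
   Phi + xi e_1) Psi, and Psi cancels. *)
pose Y := H *m map_mx (zser_map Fi) (M Psi').
have YH : Y *m map_mx (zser_map Fi) (M Psi) = H.
  by rewrite /Y -mulmxA -map_mxM e2 map_mx1 mulmx1.
have mapK N : map_mx (zser_map Fr) (map_mx (zser_map Fi) (M N)) = M N.
  by apply/matrixP => i j; rewrite !mxE (zmap_FiK HC FrE FiE).
have tY j : in_tz abs (Y 0 j).
  rewrite mxE; apply: (tz_sum HC) => k _; rewrite !mxE.
  apply: (tzM HC); first by case: (hP k).
  by apply: (tz_Fi HC FrE FiE); apply: (in_tate_z_tz HC).
have sys : map_mx (zser_map Fr) Y = Y *m M F + zconst xi *: delta_mx 0 ord0.
  apply: (@can_inj _ _ (mulmx^~ (M Psi)) (mulmx^~ (M Psi'))).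
    by move=> X; rewrite /= -mulmxA e1 mulmx1.
  rewrite /= mulmxDl -mulmxA -e3 YH -{1}(mapK Psi) -map_mxM YH.
  apply/matrixP => i j; rewrite !mxE /=; have [_ ->] := hP j; congr (_ + _).
  rewrite (bigD1 ord0) //= big1 ?addr0 => [|k k0].
    by rewrite !mxE ord1 !eqxx mulr1.
  by rewrite !mxE (negPf k0) andbF mulr0 mul0r.
(* Natural indices suit the induction in [telescope_system]; the default value of [inord] never
   enters, as only k <= r occurs. *)
pose y k := Y 0 (inord k).
pose u := y r * zconst Br.
have lastE : inord r = ord_max :> 'I_r.+1 by apply: val_inj; rewrite /= inordK.
have F_last j : (j < r)%N -> F ord_max (inord j.+1) = - zconst (S j.+1 (A j.+1) * Br).
  move=> jr; rewrite /F /Phi /= ltnn inordK ?ltnS //= !(ptw_neg FiE).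
  by rewrite -zconstN.
have F_last0 : F ord_max ord0 = zconst Br * (@zX C s - zconst (pconst theta)).
  rewrite /F /Phi /= ltnn /= (ptw_neg FiE).
  apply: funext => -[|[|n]]; rewrite coefz_const coefzD coefzN /zX /zconst /=.
  - rewrite sub0r mulrC; congr (_ * _); apply: pserP => m.
    by rewrite coefpN /pconst; case: ifP; rewrite ?oppr0.
  - by rewrite subr0 mulr1.
  - by rewrite subr0 mulr0.
have F_up (k : 'I_r.+1) (j : 'I_r.+1) : (k < r)%N ->
    F k j = if (j == k.+1 :> nat) then 1 else 0 by move=> kr; rewrite /F /Phi ltnS kr.
(* The last row of Phi is set apart. Counting from 0, the other rows contribute to column j only an
   entry 1 in row j - 1, and nothing if j = 0. *)
have sysE j : zser_map Fr (Y 0 j) =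
    Y 0 ord_max * F ord_max j + \sum_(k < r.+1 | k != ord_max) Y 0 k * F k j
    + zconst xi * (j == ord0)%:R.
  have := congr1 (fun N : 'rV__ => N 0 j) sys; rewrite !mxE eqxx /= => ->.
  congr (_ + _); rewrite (bigD1 ord_max) //= !mxE; congr (_ + _).
  by apply: eq_bigr => k _; rewrite !mxE.
have not_max (k : 'I_r.+1) : k != ord_max -> (k < r)%N.
  by rewrite -val_eqE /= ltn_neqAle => ->; rewrite -ltnS /=.
have E0 : zser_map Fr (y 0%N) = u * (@zX C s - zconst (pconst theta)) + zconst xi.
  rewrite /y (_ : inord 0 = ord0); last by apply: val_inj; rewrite /= inordK.
  rewrite sysE eqxx mulr1 F_last0 [X in _ + X + _]big1 ?addr0 => [|k /not_max kr].
    by rewrite /u /y lastE mulrA.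
  by rewrite F_up // mulr0.
have ES j : (j < r)%N -> zser_map Fr (y j.+1) = y j - u * zconst (S j.+1 (A j.+1)).
  move=> jr; rewrite {1}/y sysE F_last //.
  have -> : (inord j.+1 == ord0 :> 'I_r.+1) = false by rewrite -val_eqE /= inordK.
  rewrite mulr0 addr0 (bigD1 (inord j)) /=; last first.
    by rewrite -val_eqE /= inordK ?ltn_eqF // ltnW.
  rewrite big1 ?addr0 => [|k /andP[/not_max kr kj]].
    rewrite F_up ?inordK ?eqxx ?mulr1 // 1?ltnW // addrC; congr (_ + _).
    by rewrite mulrN zconstM /u /y lastE -!mulrA [zconst Br * _]mulrC.
  rewrite F_up // inordK // eqSS; case: eqP => [jk|]; last by rewrite mulr0.
  by move: kj; rewrite -val_eqE /= inordK -?jk ?eqxx // ltnW.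
have := telescope_system (erefl u) E0 ES => main.
(* The twist fixes z, so phi_theta acts on each coefficient in z separately, while multiplication by
   z shifts the index. *)
have coefE n : phi_act theta r.+1 A Fr (u n) = (@zX C s * u) n + zconst xi n.
  rewrite -coefzD -main coefz_sum; apply: eq_bigr => i _.
  by rewrite coefz_const.
have tu : in_tz abs u.
  apply: (tzM HC); first exact: tY.
  apply: (tz_const HC).
  exact: (tate_iter _ (tate_Fi HC FrE FiE)).
exists u; case: tu => tu1 tu2; split=> //.
- by rewrite coefE coefzXM add0r.
- by move=> n; rewrite coefE coefzXM /zconst /= addr0.
- by move=> e /tu2 [N hN]; exists N; apply: hN.
Qed.

End DifferenceEquation.

Theorem theorem4p11
  (R : realType) (C : closedFieldType) (q : nat) (theta : C) (abs : C -> R)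
  (HC : is_Cinfty q theta abs)
  (s r : nat) (Hr : (0 < r)%N)
  (A : nat -> pser C s)
  (HA : forall i, (1 <= i <= r)%N -> in_tate abs (A i))
  (Binv : pser C s)
  (HB : in_tate abs Binv)
  (HAr : forall m, pmul (A r) Binv m = pconst 1 m)
  (Psi : zmx C s r)
  (HPsi : rigid_analytic_trivialization abs q theta A Binv Psi)
  (alpha : tser C s)
  (Halpha : is_exp q theta r A alpha) :
  uniformizable abs q alpha.
Proof.
move=> xi txi; case: r Hr HA HAr Psi HPsi Halpha => // r Hr HA HAr Psi HPsi Halpha.
have [Fr [Fi [FrE FiE]]] := frobenius_exists HC.
have {}HAr : A r.+1 * Binv = 1 by apply: pserP => m; apply: HAr.
have [f [tf f0 fS fsmall]] := division_tower HC FrE FiE HB HAr HPsi txi.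
have [M [M1 hM]] := phi_coef_bounded HC HA.
have [x [tx hx]] := exp_surj_tower HC Hr HA FrE Halpha M1 hM tf f0 fS fsmall.
exists x; split=> // e /hx [N0 h]; exists N0 => N /h.
by rewrite (exp_partialE FrE).
Qed.
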